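(* Let $A$ be a (possibly unbounded) self-adjoint operator on a Hilbert space $\mathcal{H}$. For any $\lambda \in \mathrm{conv}\bigl(\widehat{\mathrm{Spec}}_{\mathrm{ess}}(A)\bigr)\setminus \widehat{\mathrm{Spec}}_{\mathrm{ess}}(A)$ there exists an increasing sequence $(\mathcal{L}_k)_{k\in\mathbb{N}} \in \Lambda(A)$ (i.e. $\mathcal{L}_k\subseteq\mathcal{L}_{k+1}$ for all $k$) such that $\lambda \in \mathrm{Spec}(A,\mathcal{L}_k)$ for all $k\in\mathbb{N}$.
   Context: Hilbert spaces are complex and not assumed separable. $\mathrm{Dom}(A)$ is the domain and $\mathrm{Spec}(A)\subseteq\mathbb{R}$ the spectrum of the self-adjoint operator $A$. $\Lambda(A)$ is the set of all sequences $(\mathcal{L}_k)_{k\in\mathbb{N}}$ of closed (in $\mathcal{H}$) linear subspaces of $\mathcal{H}$, each contained in $\mathrm{Dom}(A)$, such that the orthogonal projections $P_k:\mathcal{H}\to\mathcal{L}_k$ converge strongly to the identity operator $I$. For a closed subspace $\mathcal{L}\subseteq \mathrm{Dom}(A)$ with orthogonal projection $P:\mathcal{H}\to\mathcal{L}$, $\mathrm{Spec}(A,\mathcal{L})$ denotes the spectrum of the operator $PA:\mathcal{L}\to\mathcal{L}$. The extended spectrum $\widehat{\mathrm{Spec}}(A)$ is obtained from $\mathrm{Spec}(A)$ by adding $-\infty$ if $A$ is unbounded below and $+\infty$ if $A$ is unbounded above (both if unbounded from both sides, none if $A$ is bounded); equivalently, it is the closure of $\mathrm{Spec}(A)$ in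 $\overline{\mathbb{R}}=\mathbb{R}\cup\{\pm\infty\}$. The extended essential spectrum is $$\widehat{\mathrm{Spec}}_{\mathrm{ess}}(A) := \widehat{\mathrm{Spec}}(A)\setminus\{\text{isolated eigenvalues of } A \text{ of finite multiplicity}\},$$ where ''isolated'' means isolated as a point of $\mathrm{Spec}(A)$. $\mathrm{conv}(S)$ is the convex hull of $S\subseteq\overline{\mathbb{R}}$ in $\overline{\mathbb{R}}$, i.e. the set of all $\lambda\in\overline{\mathbb{R}}$ with $s\le\lambda\le t$ for some $s,t\in S$. *)

(* Defs.v *)
From HB Require Import structures.
From mathcomp Require Import all_boot all_order all_algebra complex.
From mathcomp Require Import boolp classical_sets functions reals.
From mathcomp Require Import ereal topology normedtype sequences.

Set Implicit Arguments.
Unset Strict Implicit.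
Unset Printing Implicit Defensive.

Import Order.TTheory GRing.Theory Num.Theory.
Import numFieldNormedType.Exports.

Local Open Scope classical_set_scope.
Local Open Scope complex_scope.
Local Open Scope ring_scope.

(** A complex Hilbert space is a complete normed module [H] over [R[i]] with an
    inner product [dot] (linear in the first argument, as in [sesquilinear])
    inducing its norm, in the following sense. Norms take values in [R[i]]. *)
Definition norm_of_dot (R : realType) (H : completeNormedModType R[i])
    (dot : {dot H for Num.conj}) : Prop :=
  forall x : H, `|x| ^+ 2 = dot x x.

(** Only the values of [op] on [dom] are meaningful; no definition below
    depends on the others. *)
Record operator (R : realType) (H : completeNormedModType R[i]) := Operator {
  dom : set H ;
  op :> H -> H ;
  dom_submod_closed : submod_closed [in dom] ;
  op_linear : forall a : R[i],
    {in dom &, forall x y, op (a *: x + y) = a *: op x + op y} }.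

Section spectra.
Variables (R : realType) (H : completeNormedModType R[i]).
Variable dot : {dot H for Num.conj}.
Implicit Types (A : operator H) (L : set H) (l : R).

Definition graph A : set (H * H) := [set p | dom A p.1 /\ p.2 = A p.1].

(** For densely defined [A] this is the graph of the adjoint of [A]. *)
Definition adjoint_graph A : set (H * H) :=
  [set p | forall x, dom A x -> dot (A x) p.1 = dot x p.2].

Definition self_adjoint A : Prop :=
  dense (dom A) /\ graph A = adjoint_graph A.

Definition closed_subspace L : Prop := submod_closed [in L] /\ closed L.

(** [T] is regarded as an operator in the Hilbert space [E], a closed subspace
    of [H], with domain [D] included in [E]: [z] is in the resolvent set when
    [T - z] has a bounded inverse [S : E -> D]. *)
Definition resolvent_set (E D : set H) (T : H -> H) : set R[i] :=
  [set z | exists S : H -> H,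
    [/\ forall y, E y -> D (S y) /\ T (S y) - z *: S y = y,
        forall x, D x -> S (T x - z *: x) = x
      & exists M : R, forall y, E y -> `|S y| <= M%:C * `|y| ]].

Definition spectrum (E D : set H) (T : H -> H) : set R[i] :=
  ~` resolvent_set E D T.

(** All spectra considered here are those of self-adjoint operators, hence
    real. *)
Definition Spec A : set R := [set l | spectrum [set: H] (dom A) A l%:C].

(** [xget] selects the projection of [x], which exists and is unique when [L]
    is a closed subspace. *)
Definition orthoproj L (x : H) : H :=
  xget 0 [set p | L p /\ forall y, L y -> dot (x - p) y = 0].

Definition Spec_in A L : set R :=
  [set l | spectrum L L (fun x => orthoproj L (A x)) l%:C].

Definition Lambda A : set (nat -> set H) :=
  [set L | (forall k, closed_subspace (L k) /\ L k `<=` dom A) /\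
           forall x : H, orthoproj (L k) x @[k --> \oo] --> x].

(** The complex inequalities say in particular that [dot (A x) x] is real,
    which always holds for self-adjoint [A]. *)
Definition bounded_below A : Prop :=
  exists m : R, forall x, dom A x -> m%:C * `|x| ^+ 2 <= dot (A x) x.

Definition bounded_above A : Prop :=
  exists m : R, forall x, dom A x -> dot (A x) x <= m%:C * `|x| ^+ 2.

Definition ext_Spec A : set (\bar R) :=
  (EFin @` Spec A)
  `|` [set s | s = -oo%E /\ ~ bounded_below A]
  `|` [set s | s = +oo%E /\ ~ bounded_above A].

Definition eigenspace A l : set H := [set x | dom A x /\ A x = l%:C *: x].

Definition eigenvalue A l : Prop := exists2 x, eigenspace A l x & x != 0.

Definition finite_multiplicity A l : Prop :=
  exists s : seq H, forall x, eigenspace A l x ->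
    exists c : nat -> R[i], x = \sum_(i < size s) c i *: s`_i.

Definition discrete_Spec A : set R :=
  [set l | [/\ isolated (Spec A) l, eigenvalue A l & finite_multiplicity A l]].

Definition ext_Spec_ess A : set (\bar R) :=
  ext_Spec A `\` (EFin @` discrete_Spec A).

End spectra.

Definition ext_conv (R : realType) (S : set (\bar R)) : set (\bar R) :=
  [set l | exists s t : \bar R, [/\ S s, S t & (s <= l <= t)%E]].

(* Main.v *)
(** Fix a real point [m] of the resolvent set near [lambda] ([lambda] itself
    unless it is an eigenvalue) and let [T = (A - m)^-1], a bounded injective
    symmetric operator whose range is the domain of [A]. A spectral projection
    [E] of [T] splits [H] into two reducing subspaces where [T >= 0] and
    [T <= 0]. Extended essential spectrum on both sides of [lambda] means that
    each of them is the closure of the union of increasing, proper reducing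
    subspaces contained in [Dom A]. Adding the two sequences gives increasing
    reducing subspaces [G_k] of [Dom A] with dense union and with [T] indefinite
    on each complement of [G_k]; hence some [y <> 0] orthogonal to [G_k], in a
    later [G_m], satisfies [<T y, y> = 0]. Then [x = T y] satisfies
    [(A - lambda) x = y], which is orthogonal to [L_k = G_k + C x], so that
    [lambda] is an eigenvalue of the compression of [A] to [L_k]. If [lambda] is
    an eigenvalue of [A], subspaces [G_k] containing an eigenvector suffice.

    Closed subspaces are handled through their orthogonal projections, and the
    only spectral projections needed are those on the kernel of [|B| - B]. *)
Require Import Defs.
From mathcomp Require Import all_boot all_order all_algebra complex.
From mathcomp Require Import boolp classical_sets functions reals.
From mathcomp Require Import ereal topology normedtype sequences.
From mathcomp Require Import ring lra.

Import Order.TTheory GRing.Theory Num.Theory.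
Import numFieldNormedType.Exports.

Local Open Scope classical_set_scope.
Local Open Scope complex_scope.
Local Open Scope ring_scope.

Local Notation Re := complex.Re.

Section HilbertSpace.
Set Implicit Arguments.
Unset Strict Implicit.
Variables (R : realType) (H : completeNormedModType R[i]).
Variable dot : {dot H for Num.conj}.
Hypothesis Hdot : norm_of_dot dot.
Implicit Types (x y z : H) (r : R) (a : R[i]) (L : set H) (S T P Q : H -> H).

(** * Real-valued norm and inner product, limits and completeness *)

Definition hnorm x : R := Re `|x|.
Definition rdot x y : R := Re (dot x y).

Lemma normE x : `|x| = (hnorm x)%:C.
Proof. by rewrite /hnorm RRe_real // normr_real. Qed.

Lemma hnorm_ge0 x : 0 <= hnorm x.
Proof. by rewrite -ler0c -normE. Qed.

Lemma hnorm_eq0 x : hnorm x = 0 -> x = 0.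
Proof. by move=> h; apply/normr0_eq0; rewrite normE h. Qed.

Lemma hnorm0 : hnorm 0 = 0.
Proof. by rewrite /hnorm normr0. Qed.

Lemma hnormD x y : hnorm (x + y) <= hnorm x + hnorm y.
Proof. by rewrite -lecR rmorphD /= -!normE ler_normD. Qed.

Lemma hnormN x : hnorm (- x) = hnorm x.
Proof. by rewrite /hnorm normrN. Qed.

Lemma hdistC x y : hnorm (x - y) = hnorm (y - x).
Proof. by rewrite /hnorm distrC. Qed.

Lemma hnormB x y : hnorm (x - y) <= hnorm x + hnorm y.
Proof. by rewrite -(hnormN y) hnormD. Qed.

Lemma hdistD z x y : hnorm (x - y) <= hnorm (x - z) + hnorm (z - y).
Proof. by rewrite (_ : x - y = x - z + (z - y)) ?hnormD // addrA subrK. Qed.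

Lemma hnormZ r x : hnorm (r%:C *: x) = `|r| * hnorm x.
Proof.
apply: (@complexI R); rewrite rmorphM /= -!normE normrZ; congr (_ * _).
by rewrite normc_def /= expr0n addr0 sqrtr_sqr.
Qed.

Lemma dotC x y : dot x y = (dot y x)^*.
Proof. by rewrite (hermC dot x y) expr0 mul1r. Qed.

Lemma dotDl x y z : dot (x + y) z = dot x z + dot y z.
Proof. exact: linearDl. Qed.

Lemma dotDr x y z : dot x (y + z) = dot x y + dot x z.
Proof. exact: linearDr. Qed.

Lemma dotBl x y z : dot (x - y) z = dot x z - dot y z.
Proof. exact: linearBl. Qed.

Lemma dotBr x y z : dot x (y - z) = dot x y - dot x z.
Proof. exact: linearBr. Qed.

Lemma dot0l x : dot 0 x = 0.
Proof. exact: linear0l. Qed.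

Lemma dot0r x : dot x 0 = 0.
Proof. exact: linear0r. Qed.

Lemma dotZr a x y : dot x (a *: y) = a^* * dot x y.
Proof. by rewrite linearZr_LR. Qed.

Lemma dotZl a x y : dot (a *: x) y = a * dot x y.
Proof. by rewrite linearZl_LR. Qed.

Lemma dot_eq0C x y : dot x y = 0 -> dot y x = 0.
Proof. by move=> h; rewrite dotC h rmorph0. Qed.

Lemma rdotC x y : rdot x y = rdot y x.
Proof. by rewrite /rdot dotC; case: (dot y x). Qed.

Lemma rdotDl x y z : rdot (x + y) z = rdot x z + rdot y z.
Proof. by rewrite /rdot linearDl raddfD. Qed.

Lemma rdotBl x y z : rdot (x - y) z = rdot x z - rdot y z.
Proof. by rewrite /rdot linearBl raddfB. Qed.

Lemma rdotZl r x z : rdot (r%:C *: x) z = r * rdot x z.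
Proof. by rewrite /rdot dotZl; case: (dot x z) => u v /=; rewrite mul0r subr0. Qed.

Lemma rdotDr x y z : rdot x (y + z) = rdot x y + rdot x z.
Proof. by rewrite !(rdotC x) rdotDl. Qed.

Lemma rdotBr x y z : rdot x (y - z) = rdot x y - rdot x z.
Proof. by rewrite !(rdotC x) rdotBl. Qed.

Lemma rdotZr r x z : rdot x (r%:C *: z) = r * rdot x z.
Proof. by rewrite !(rdotC x) rdotZl. Qed.

Lemma rdot0l x : rdot 0 x = 0.
Proof. by rewrite /rdot linear0l. Qed.

Lemma sqr_hnorm x : hnorm x ^+ 2 = rdot x x.
Proof. by rewrite /rdot -Hdot normE -rmorphXn. Qed.

Lemma sqr_hnormB x y : hnorm (x - y) ^+ 2 = hnorm x ^+ 2 - 2 * rdot x y + hnorm y ^+ 2.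
Proof. rewrite !sqr_hnorm rdotBl !rdotBr (rdotC y x); ring. Qed.

Lemma rdot_le x y : rdot x y <= hnorm x * hnorm y.
Proof.
have [->|x0] := eqVneq x 0; first by rewrite rdot0l hnorm0 mul0r.
have [->|y0] := eqVneq y 0; first by rewrite rdotC rdot0l hnorm0 mulr0.
have hp z : z != 0 -> 0 < hnorm z.
  by move=> z0; rewrite lt_def hnorm_ge0 andbT; apply: contra_neq z0; exact: hnorm_eq0.
have := sqr_ge0 (hnorm ((hnorm y)%:C *: x - (hnorm x)%:C *: y)).
rewrite sqr_hnormB !hnormZ rdotZl rdotZr !ger0_norm ?hnorm_ge0 //.
move=> h; have : 0 <= 2 * (hnorm x * hnorm y) * (hnorm x * hnorm y - rdot x y) by lra.
by rewrite pmulr_rge0 ?subr_ge0 // !mulr_gt0 ?hp.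
Qed.

Lemma rdot_ge x y : - (hnorm x * hnorm y) <= rdot x y.
Proof. have := rdot_le (- x) y; rewrite hnormN -sub0r rdotBl rdot0l; lra. Qed.

Lemma rdot_norm_le x y : `|rdot x y| <= hnorm x * hnorm y.
Proof. by rewrite ler_norml rdot_ge rdot_le. Qed.

Lemma rdot0_eq0 x : rdot x x = 0 -> x = 0.
Proof. by rewrite -sqr_hnorm => /eqP; rewrite sqrf_eq0 => /eqP /hnorm_eq0. Qed.

Lemma dot_nondeg x : (forall y, dot x y = 0) -> x = 0.
Proof. by move=> h; apply: rdot0_eq0; rewrite /rdot h. Qed.

(** Real parts determine the inner product; on a complex subspace, vanishing of [rdot] therefore
    gives complex orthogonality. *)
Lemma dot_rdot x y : dot x y = rdot x y +i* rdot x ('i *: y).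
Proof.
rewrite /rdot dotZr; case: (dot x y) => u v /=; congr (_ +i* _).
by rewrite mul0r sub0r mulN1r opprK.
Qed.

Definition hlim (u : nat -> H) l :=
  forall e : R, 0 < e -> exists N, forall n, (N <= n)%N -> hnorm (u n - l) < e.

Lemma cplx_gt0 (e : R[i]) : 0 < e -> e = (Re e)%:C /\ 0 < Re e.
Proof. by case: e => u v; rewrite ltcE /= => /andP[/eqP -> ?]. Qed.

Lemma hlimP (u : nat -> H) l : hlim u l -> u n @[n --> \oo] --> l.
Proof.
move=> ul; apply/cvgrPdist_lt => e /cplx_gt0[-> /ul[N hN]].
by exists N => // n /= Nn; rewrite normE ltcR hdistC hN.
Qed.

Lemma hcauchy (u : nat -> H) :
  (forall e : R, 0 < e -> exists N, forall m n, (N <= m)%N -> (N <= n)%N ->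
     hnorm (u m - u n) < e) ->
  exists l, hlim u l.
Proof.
move=> hu.
have /cvg_ex[l ul] : cvg (u @ \oo).
  apply/cauchy_cvgP/cauchy_ballP => e /cplx_gt0[-> /hu[N hN]].
  near_simpl; near=> m n; rewrite -ball_normE /= normE ltcR.
  by apply: hN; [near: m|near: n]; exists N.
exists l => e e0; have e0' : 0 < e%:C by rewrite ltcR.
have /cvgrPdist_lt/(_ _ e0')[N _ hN] := ul.
by exists N => n /hN /=; rewrite normE ltcR hdistC.
Unshelve. all: by end_near. Qed.

Definition hclosed L :=
  forall x, (forall e : R, 0 < e -> exists2 y, L y & hnorm (x - y) < e) -> L x.

Lemma hclosedP L : hclosed L -> closed L.
Proof.
move=> Lc x xL; apply: Lc => e e0.
have /xL[y [Ly]] : nbhs x (ball x e%:C) by apply: nbhsx_ballx; rewrite ltcR.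
by rewrite -ball_normE /= normE ltcR => xy; exists y.
Qed.

(** * Symmetric operators and orthogonal projections *)

Definition hsym T := forall x y, dot (T x) y = dot x (T y).

Definition commute_op S T := forall x, S (T x) = T (S x).

Definition hbounded T := exists2 M : R, 0 < M & forall x, hnorm (T x) <= M * hnorm x.

Definition hproj P := hsym P /\ forall x, P (P x) = P x.

Section Symmetric.
Variables (T : H -> H) (Tsym : hsym T).

(** Once [T] is moved to the test vector [z], both sides agree against every [z]; thus [hsym]
    carries linearity with it. *)
Lemma hsymP a x y : T (a *: x + y) = a *: T x + T y.
Proof.
apply/eqP; rewrite -subr_eq0; apply/eqP/dot_nondeg => z.
by rewrite dotBl Tsym !dotDl !dotZl !Tsym subrr.
Qed.

Lemma hsymD x y : T (x + y) = T x + T y.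
Proof. by rewrite -(scale1r x) hsymP !scale1r. Qed.

Lemma hsym0 : T 0 = 0.
Proof. by apply: (addIr (T 0)); rewrite -hsymD !add0r. Qed.

Lemma hsymZ a x : T (a *: x) = a *: T x.
Proof. by rewrite -[a *: x]addr0 hsymP hsym0 !addr0. Qed.

Lemma hsymN x : T (- x) = - T x.
Proof. by rewrite -scaleN1r hsymZ scaleN1r. Qed.

Lemma hsymB x y : T (x - y) = T x - T y.
Proof. by rewrite hsymD hsymN. Qed.

Lemma hsym_rdot x y : rdot (T x) y = rdot x (T y).
Proof. by rewrite /rdot Tsym. Qed.

End Symmetric.

Lemma hsym_of_rdot T : (forall x y, rdot (T x) y = rdot x (T y)) ->
  (forall x, T ('i *: x) = 'i *: T x) -> hsym T.
Proof. by move=> h hi x y; rewrite !dot_rdot !h hi. Qed.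

Lemma hproj_le P x : hproj P -> hnorm (P x) <= hnorm x.
Proof.
move=> [Ps PP]; have [/eqP h|h] := eqVneq (hnorm (P x)) 0; first by rewrite (eqP h) hnorm_ge0.
have p0 : 0 < hnorm (P x) by rewrite lt_def h hnorm_ge0.
by rewrite -(ler_pM2l p0) -expr2 sqr_hnorm (hsym_rdot Ps) PP rdotC rdot_le.
Qed.

Lemma hproj_id : hproj id.
Proof. by []. Qed.

Lemma hproj_compl P : hproj P -> hproj (fun x => x - P x).
Proof.
move=> [Ps PP]; split=> [x y|x]; first by rewrite dotBl dotBr Ps.
by rewrite (hsymB Ps) PP subrr subr0.
Qed.

Lemma hproj_comp P Q : hproj P -> hproj Q -> commute_op P Q -> hproj (fun x => P (Q x)).
Proof.
move=> [Ps PP] [Qs QQ] c; split=> [x y|x]; first by rewrite Ps Qs c.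
by rewrite -(c (Q x)) QQ PP.
Qed.

Lemma hproj_add P Q : hproj P -> hproj Q -> (forall x, P (Q x) = 0) ->
  hproj (fun x => P x + Q x).
Proof.
move=> [Ps PP] [Qs QQ] PQ; have QP x : Q (P x) = 0.
  by apply: dot_nondeg => y; rewrite Qs Ps PQ dot0r.
split=> [x y|x]; first by rewrite dotDl dotDr Ps Qs.
by rewrite (hsymD Ps) (hsymD Qs) PP QQ PQ QP addr0 add0r.
Qed.

Lemma pythagoras P x : hproj P -> hnorm x ^+ 2 = hnorm (P x) ^+ 2 + hnorm (x - P x) ^+ 2.
Proof.
move=> [Ps PP]; rewrite sqr_hnormB !(sqr_hnorm (P x)).
rewrite (hsym_rdot Ps x) PP (rdotC x); ring.
Qed.

(** * The projection theorem for closed subspaces *)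

Definition hsubspace L := L 0 /\ forall a x y, L x -> L y -> L (a *: x + y).

Lemma hsubspaceB L x y : hsubspace L -> L x -> L y -> L (x - y).
Proof. by move=> [_ Ll] Lx Ly; rewrite addrC -scaleN1r; apply: Ll. Qed.

Lemma hsubspaceZ L a x : hsubspace L -> L x -> L (a *: x).
Proof. by move=> [L0 Ll] Lx; rewrite -[_ *: _]addr0; apply: Ll. Qed.

Lemma archi_lt (e : R) : 0 < e -> exists n : nat, n.+1%:R^-1 < e.
Proof.
move=> e0; have := archi_boundP (ltW (_ : 0 < e^-1)); rewrite invr_gt0 => /(_ e0) h.
exists (Num.bound e^-1); rewrite -[ltRHS]invrK ltf_pV2 ?posrE ?invr_gt0 //.
by apply: lt_trans h _; rewrite ltr_nat.
Qed.

Lemma inv_le (m n : nat) : (m <= n)%N -> n.+1%:R^-1 <= m.+1%:R^-1 :> R.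
Proof. by move=> mn; rewrite lef_pV2 ?posrE ?ltr0n // ler_nat. Qed.

Lemma inv_gt0 (m : nat) : 0 < m.+1%:R^-1 :> R.
Proof. by rewrite invr_gt0 ltr0n. Qed.

Lemma nearest_point L x : hsubspace L -> hclosed L ->
  exists2 p, L p & forall y, L y -> hnorm (x - p) <= hnorm (x - y).
Proof.
move=> Ls Lc; pose D : set R := [set hnorm (x - y) | y in L].
have Dl : has_inf D.
  split; first by exists (hnorm (x - 0)), 0 => //; case: Ls.
  by exists 0 => _ [y _ <-]; exact: hnorm_ge0.
pose d := inf D.
have dle y : L y -> d <= hnorm (x - y) by move=> Ly; apply: ge_inf; [case: Dl|exists y].
have d0 : 0 <= d.
  by apply: lb_le_inf; [case: Dl|move=> _ [y _ <-]; exact: hnorm_ge0].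
have /choice[u hu] n : exists y, L y /\ hnorm (x - y) < d + n.+1%:R^-1.
  have [_ [y Ly <-] h] := inf_adherent (inv_gt0 n) Dl.
  by exists y.
(* By the parallelogram law and midpoints lying in [L], the left side is at most
   [4 (d + e)^2 - 4 d^2 = 8 d e + 4 e^2] with [e = 1/(k+1) <= 1]; hence the constant. *)
have close (m n k : nat) : (k <= m)%N -> (k <= n)%N ->
    hnorm (u m - u n) ^+ 2 <= (8 * d + 4) * k.+1%:R^-1.
  move=> km kn; set e : R := k.+1%:R^-1.
  have [e0 e1] : 0 < e /\ e <= 1 by split; [exact: inv_gt0|have := inv_le (leq0n k); rewrite invr1].
  have hm : hnorm (x - u m) <= d + e by rewrite (le_trans (ltW (hu m).2)) // lerD2l inv_le.
  have hn : hnorm (x - u n) <= d + e by rewrite (le_trans (ltW (hu n).2)) // lerD2l inv_le.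
  have /dle hmid : L ((2^-1)%:C *: (u m + u n)).
    apply: hsubspaceZ => //; rewrite -(scale1r (u m)); apply: Ls.2; first exact: (hu m).1.
    exact: (hu n).1.
  have par : hnorm (u m - u n) ^+ 2 = 2 * hnorm (x - u m) ^+ 2 + 2 * hnorm (x - u n) ^+ 2
      - 4 * hnorm (x - (2^-1)%:C *: (u m + u n)) ^+ 2.
    rewrite !sqr_hnormB !sqr_hnorm rdotZl !rdotZr rdotDl !rdotDr (rdotC (u n) (u m)).
    by field.
  rewrite par.
  move: (e) e0 e1 hm hn => {}e e0 e1 hm hn.
  have q1 := hnorm_ge0 (x - u m); have q2 := hnorm_ge0 (x - u n).
  by nra.
have [p hp] : exists p, hlim u p.
  apply: hcauchy => e e0.
  have c0 : 0 < 8 * d + 4 by lra.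
  have [N hN] : exists n : nat, n.+1%:R^-1 < e ^+ 2 / (8 * d + 4).
    by apply: archi_lt; rewrite divr_gt0 ?exprn_gt0.
  exists N => m n Nm Nn; rewrite -(ltr_pXn2r (n := 2)) ?nnegrE ?hnorm_ge0 ?(ltW e0) //.
  by apply: le_lt_trans (close _ _ _ Nm Nn) _; rewrite mulrC -ltr_pdivlMr.
exists p.
  apply: Lc => e /hp[N hN]; exists (u N); first exact: (hu N).1.
  by rewrite hdistC hN.
move=> y /dle dy; apply: le_trans dy; apply/ler_addgt0Pl => e e0.
have [N hN] := hp (e / 2) (divr_gt0 e0 (ltr0n _ 2)).
have [n hn] := archi_lt (divr_gt0 e0 (ltr0n _ 2)).
have := hN (maxn N n) (leq_maxl _ _); have := inv_le (leq_maxr N n).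
have := (hu (maxn N n)).2; have := hdistD (u (maxn N n)) x p.
move: hn; move: (n.+1%:R^-1 : R) ((maxn N n).+1%:R^-1 : R) => i j; lra.
Qed.

(** At [r = - b / (1 + |c|)] the expression is [b^2 / (1 + |c|)^2] times a negative number. *)
Lemma quad_ge0_eq0 (b c : R) : (forall r, 0 <= r * b + r ^+ 2 * c) -> b = 0.
Proof.
move=> h; apply/eqP; apply: contraT => b0.
have c1 : 0 < 1 + `|c| by rewrite ltr_pwDl.
have := h (- b / (1 + `|c|)).
rewrite (_ : _ + _ = (b ^+ 2 / (1 + `|c|) ^+ 2) * (c - (1 + `|c|))); last first.
  by field; rewrite gt_eqF.
rewrite pmulr_rge0; last first.
  by apply: divr_gt0; [rewrite exprn_even_gt0|exact: exprn_gt0].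
have := ler_norm c; lra.
Qed.

Theorem projection_theorem L : hsubspace L -> hclosed L ->
  exists P, [/\ hproj P, forall x, L (P x) & forall x, L x -> P x = x].
Proof.
move=> Ls Lc.
have /choice[P hP] x : exists p, L p /\ forall y, L y -> dot (x - p) y = 0.
  have [p Lp hp] := nearest_point x Ls Lc; exists p; split=> //.
  (* Minimality of [p] along the real line [p + r y] kills the first-order term. *)
  have rd y : L y -> rdot (x - p) y = 0.
    move=> Ly; suff : - 2 * rdot (x - p) y = 0 by lra.
    apply: (@quad_ge0_eq0 _ (hnorm y ^+ 2)) => r.
    have : hnorm (x - p) <= hnorm (x - p - r%:C *: y).
      by rewrite -addrA -opprD; apply: hp; rewrite addrC; apply: Ls.2.
    rewrite -(ler_pXn2r (n := 2)) ?nnegrE ?hnorm_ge0 // (sqr_hnormB (x - p)) hnormZ rdotZr.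
    rewrite exprMn real_normK ?num_real //; lra.
  move=> y Ly; rewrite dot_rdot (rd _ Ly) rd //; exact: hsubspaceZ.
have PL x : L (P x) := (hP x).1.
have Po x y : L y -> dot (x - P x) y = 0 := (hP x).2 y.
have Pid x : L x -> P x = x.
  move=> Lx; apply/esym/eqP; rewrite -subr_eq0; apply/eqP/rdot0_eq0.
  by rewrite /rdot Po //; apply: hsubspaceB.
exists P; split=> //; split=> [x y|x]; last exact/Pid.
have e1 : dot (P x) y = dot (P x) (P y).
  apply/eqP; rewrite -subr_eq0 -dotBr; apply/eqP.
  by apply: dot_eq0C; exact: Po.
have e2 : dot x (P y) = dot (P x) (P y).
  by apply/eqP; rewrite -subr_eq0 -dotBl; apply/eqP; rewrite Po.
by rewrite e1 e2.
Qed.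

(** Invariance under a symmetric [T] makes the orthogonal complement invariant too. *)
Lemma hproj_commute P T : hproj P -> hsym T ->
  (forall x, P x = x -> P (T x) = T x) -> commute_op P T.
Proof.
move=> [Ps PP] Ts h x; have PTP y : P (T (P y)) = T (P y) by apply: h; apply: PP.
apply/eqP; rewrite -subr_eq0; apply/eqP/dot_nondeg => y.
by rewrite dotBl Ps Ts -PTP -Ps -Ts -Ps PTP subrr.
Qed.

(** * Square roots and spectral projections *)

Lemma dotZr_real r x y : dot x (r%:C *: y) = r%:C * dot x y.
Proof. by rewrite dotZr conj_Creal ?complex_real. Qed.

(** [1 - sqrtY] is the square root of [1 - X], obtained by iterating
    [Y := (X + Y^2) / 2]; the scalar iteration [sqrty] with [X] replaced by [1]
    controls the increments in norm. *)
Section SquareRoot.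
Variable X : H -> H.
Hypotheses (Xsym : hsym X) (Xle : forall x, hnorm (X x) <= hnorm x).

Fixpoint sqrtY n x : H :=
  if n is m.+1 then (2^-1)%:C *: (X x + sqrtY m (sqrtY m x)) else 0.

Lemma sqrtYS n x : sqrtY n.+1 x = (2^-1)%:C *: (X x + sqrtY n (sqrtY n x)).
Proof. by []. Qed.

Fixpoint sqrty n : R := if n is m.+1 then (1 + sqrty m ^+ 2) / 2 else 0.

Lemma sqrty_bounds n : 0 <= sqrty n <= 1.
Proof. by elim: n => [|n /andP[h0 h1]] /=; rewrite ?lexx ?ler01 //; nra. Qed.

Lemma sqrty_le n : sqrty n <= sqrty n.+1.
Proof. by have /= := sqr_ge0 (1 - sqrty n); lra. Qed.

Lemma sqrtY_sym n : hsym (sqrtY n).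
Proof.
elim: n => [|n IH] x y /=; first by rewrite dot0l dot0r.
by rewrite dotZl dotZr_real dotDl dotDr Xsym !IH.
Qed.

Lemma sqrtY_commute C n : hsym C -> commute_op C X -> commute_op C (sqrtY n).
Proof.
move=> Cs CX; elim: n => [|n IH] x /=; first by rewrite (hsym0 Cs).
by rewrite (hsymZ Cs) (hsymD Cs) CX !IH.
Qed.

Lemma sqrtY_le n x : hnorm (sqrtY n x) <= sqrty n * hnorm x.
Proof.
elim: n x => [|n IH] x /=; first by rewrite hnorm0 mul0r.
rewrite hnormZ ger0_norm; last by lra.
have := hnormD (X x) (sqrtY n (sqrtY n x)); have := Xle x; have := IH (sqrtY n x).
have /andP[h0 _] := sqrty_bounds n; have := ler_wpM2l h0 (IH x); lra.
Qed.

(** The iterates commute, so [Y_(n+2) - Y_(n+1) = (Y_(n+1) + Y_n) (Y_(n+1) - Y_n) / 2]. The scalar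
    sequence obeys the same identity, and the bound follows by induction. *)
Lemma sqrtY_step n x :
  hnorm (sqrtY n.+1 x - sqrtY n x) <= (sqrty n.+1 - sqrty n) * hnorm x.
Proof.
elim: n x => [|n IH] x.
  have := sqrtY_le 1 x; rewrite (_ : sqrtY 0 x = 0) // (_ : sqrty 0 = 0) // !subr0; lra.
have comm y : sqrtY n (sqrtY n.+1 y) = sqrtY n.+1 (sqrtY n y).
  apply: sqrtY_commute; first exact: sqrtY_sym.
  by move=> z; apply/esym/sqrtY_commute.
set d := sqrtY n.+1 x - sqrtY n x.
have -> : sqrtY n.+2 x - sqrtY n.+1 x = (2^-1)%:C *: (sqrtY n.+1 d + sqrtY n d).
  rewrite (sqrtYS n.+1) [X in _ - X]sqrtYS -scalerBr opprD addrACA subrr add0r.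
  by congr (_ *: _); rewrite /d !(hsymB (sqrtY_sym _)) comm addrA subrK.
rewrite hnormZ ger0_norm; last by lra.
have := hnormD (sqrtY n.+1 d) (sqrtY n d).
have := sqrtY_le n.+1 d; have := sqrtY_le n d.
have /andP[h0 _] := sqrty_bounds n; have /andP[h1 _] := sqrty_bounds n.+1.
have := ler_wpM2l h0 (IH x); have := ler_wpM2l h1 (IH x); rewrite -/d.
rewrite [sqrty n.+2]/= -/(sqrty n.+1).
have -> : sqrty n.+1 = (1 + sqrty n ^+ 2) / 2 by [].
lra.
Qed.

Lemma sqrtY_dist m n x : (n <= m)%N ->
  hnorm (sqrtY m x - sqrtY n x) <= (sqrty m - sqrty n) * hnorm x.
Proof.
move=> /subnKC <-; elim: (m - n)%N => [|k IH]; first by rewrite addn0 !subrr hnorm0 mul0r.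
rewrite addnS; have := hdistD (sqrtY (n + k) x) (sqrtY (n + k).+1 x) (sqrtY n x).
have := sqrtY_step (n + k) x; lra.
Qed.

Lemma sqrty_lim : exists2 l, l <= 1 & (forall n, sqrty n <= l) /\
  forall e : R, 0 < e -> exists N, forall n, (N <= n)%N -> l - sqrty n < e.
Proof.
pose D : set R := range sqrty.
have hD : has_sup D.
  split; first by exists (sqrty 0), 0%N.
  by exists 1 => _ [n _ <-]; have /andP[] := sqrty_bounds n.
exists (sup D).
  by apply: ge_sup; [case: hD|move=> _ [n _ <-]; have /andP[] := sqrty_bounds n].
have le n : sqrty n <= sup D by apply: ub_le_sup; [case: hD|exists n].
split=> // e e0; have [_ [N _ <-] hN] := sup_adherent e0 hD.
exists N => n Nn; have : sqrty N <= sqrty n.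
  by apply: (homo_leq (@lexx _ _) (@le_trans _ _)) Nn; exact: sqrty_le.
lra.
Qed.

(** The iterates converge pointwise, their increments being dominated by those of a convergent
    scalar sequence. The third clause is [(1 - Y)^2 = 1 - X]. *)
Lemma sqrt_one_sub : exists Y, [/\ hsym Y, forall x, hnorm (Y x) <= hnorm x,
  forall x, Y x + Y x = X x + Y (Y x)
  & forall C, hsym C -> commute_op C X -> commute_op C Y].
Proof.
have [l l1 [yl hl]] := sqrty_lim.
have /choice[Y hY] x : exists v, hlim (fun n => sqrtY n x) v.
  apply: hcauchy => e e0; have c0 : 0 < 1 + hnorm x by rewrite ltr_pwDl ?hnorm_ge0.
  have [N hN] := hl (e / (1 + hnorm x)) (divr_gt0 e0 c0).
  have h m n : (N <= n)%N -> (n <= m)%N -> hnorm (sqrtY m x - sqrtY n x) < e.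
    move=> Nn nm; apply: le_lt_trans (sqrtY_dist x nm) _.
    have := hN _ Nn; rewrite ltr_pdivlMr // => h1; have := yl m; have := hnorm_ge0 x.
    have := yl n; nra.
  exists N => m n Nm Nn; case/orP: (leq_total n m) => nm; first exact: h.
  by rewrite hdistC; apply: h.
have Yd n x : hnorm (Y x - sqrtY n x) <= (l - sqrty n) * hnorm x.
  apply/ler_addgt0Pl => e e0; have [N hN] := hY x e e0.
  have := hN (maxn N n) (leq_maxl _ _); have := sqrtY_dist x (leq_maxr N n).
  have := hdistD (sqrtY (maxn N n) x) (Y x) (sqrtY n x).
  rewrite (hdistC (Y x) (sqrtY (maxn N n) x)).
  have := ler_wpM2r (hnorm_ge0 x) (yl (maxn N n)); lra.
(* Each passage to the limit below is reduced to this form. *)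
have small (c z : R) : 0 <= c -> (forall n, z <= c * (l - sqrty n)) -> z <= 0.
  move=> c0 hz; apply/ler_addgt0Pl => e e0; rewrite addr0.
  have c1 : 0 < 1 + c by rewrite ltr_pwDl.
  have [N /(_ N (leqnn N))] := hl (e / (1 + c)) (divr_gt0 e0 c1).
  rewrite ltr_pdivlMr // => h; have := hz N; have := yl N; lra.
have Yle x : hnorm (Y x) <= hnorm x.
  rewrite -subr_le0; apply: (small (hnorm x)) => [|n]; first exact: hnorm_ge0.
  have := Yd n x; have := hdistD (sqrtY n x) (Y x) 0; rewrite !subr0.
  have := sqrtY_le n x; have /andP[_ y1] := sqrty_bounds n.
  have := ler_wpM2r (hnorm_ge0 x) y1; lra.
have Ycomm C : hsym C -> commute_op C X -> commute_op C Y.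
  move=> Cs CX x; apply/eqP; rewrite -subr_eq0; apply/eqP/rdot0_eq0.
  set z := C (Y x) - Y (C x).
  suff : rdot z z <= 0.
    by move=> h; apply/eqP; rewrite eq_le h -sqr_hnorm sqr_ge0.
  apply: (small (hnorm x * hnorm (C z) + hnorm (C x) * hnorm z)) => [|n].
    by rewrite addr_ge0 ?mulr_ge0 ?hnorm_ge0.
  rewrite {1}/z (_ : C (Y x) - _ = C (Y x - sqrtY n x) + - (Y (C x) - sqrtY n (C x))).
    rewrite rdotDl (hsym_rdot Cs).
    have := rdot_le (Y x - sqrtY n x) (C z); have := rdot_le (- (Y (C x) - sqrtY n (C x))) z.
    rewrite hnormN.
    have := ler_wpM2r (hnorm_ge0 (C z)) (Yd n x).
    have := ler_wpM2r (hnorm_ge0 z) (Yd n (C x)); lra.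
  rewrite (hsymB Cs) (sqrtY_commute _ Cs CX) opprB addrA.
  by rewrite -[in RHS](addrA (C (Y x))) addNr addr0.
have Ysym : hsym Y.
  apply: hsym_of_rdot => [x y|x].
    apply/eqP; rewrite eq_le -!(subr_le0 (rdot _ _)).
    have h u v : rdot (Y u) v - rdot u (Y v) <= 0.
      apply: (small (2 * hnorm u * hnorm v)) => [|n]; first by rewrite !mulr_ge0 ?hnorm_ge0.
      have := rdot_le (Y u - sqrtY n u) v; have := rdot_ge u (Y v - sqrtY n v).
      rewrite rdotBl rdotBr (hsym_rdot (@sqrtY_sym n)).
      have := ler_wpM2r (hnorm_ge0 v) (Yd n u); have := ler_wpM2l (hnorm_ge0 u) (Yd n v).
      lra.
    by rewrite h -(rdotC (Y y)) -(rdotC y) h.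
  apply/eqP; rewrite -subr_eq0; apply/eqP/hnorm_eq0/eqP.
  rewrite eq_le hnorm_ge0 andbT; apply: (small (hnorm ('i *: x) + hnorm x)) => [|n].
    by rewrite addr_ge0 ?hnorm_ge0.
  have := hdistD (sqrtY n ('i *: x)) (Y ('i *: x)) ('i *: Y x).
  rewrite {2}(hsymZ (@sqrtY_sym n)) -scalerBr.
  have hi z : hnorm ('i *: z) = hnorm z.
    rewrite /hnorm normrZ normc_def /= expr0n expr1n add0r sqrtr1 mul1r //.
  have := Yd n ('i *: x); have := Yd n x; rewrite !hi (hdistC (sqrtY n x)); lra.
exists Y; split=> // x.
apply/eqP; rewrite -subr_eq0; apply/eqP/hnorm_eq0/eqP.
rewrite eq_le hnorm_ge0 andbT; apply: (small (4 * hnorm x)) => [|n].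
  by rewrite mulr_ge0 ?hnorm_ge0.
(* Subtracting [2 Y_(n+1) = X + Y_n^2] leaves four error terms, each of norm at most
   [(l - sqrty n) * hnorm x]; hence the factor 4. *)
have e1 : Y x + Y x - (X x + Y (Y x)) =
    (Y x - sqrtY n.+1 x) + (Y x - sqrtY n.+1 x) - (Y (Y x) - sqrtY n (Y x))
    - sqrtY n (Y x - sqrtY n x).
  have e2 : sqrtY n.+1 x + sqrtY n.+1 x = X x + sqrtY n (sqrtY n x).
    rewrite /= -scalerDl -rmorphD /= (_ : 2^-1 + 2^-1 = 1 :> R) ?scale1r //; lra.
  rewrite addrACA -(opprD (sqrtY n.+1 x)) e2 (hsymB (@sqrtY_sym n)).
  rewrite !opprD !opprK !addrA addrK; set a := Y x + Y x - X x.
  by rewrite [RHS]addrAC subrK.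
rewrite e1.
have l1n := sqrty_le n; have := Yd n.+1 x; have := Yd n (Y x); have := Yd n x.
set p := Y x - sqrtY n.+1 x; set q := Y (Y x) - _; set s := Y x - _.
have := sqrtY_le n s; have /andP[_ y1] := sqrty_bounds n.
have := hnormB (p + p - q) (sqrtY n s); have := hnormB (p + p) q; have := hnormD p p.
have := ler_wpM2r (hnorm_ge0 s) y1; have ln : 0 <= l - sqrty n by rewrite subr_ge0.
have := ler_wpM2l ln (Yle x); have := ler_wpM2r (hnorm_ge0 x) l1n.
lra.
Qed.

End SquareRoot.

(** A bounded [S] has closed kernel; a symmetric [C] commuting with [S] preserves it, hence commutes
    with the projection onto it. *)
Lemma kernel_proj S : hsym S -> hbounded S -> exists K, [/\ hproj K,
  forall x, S (K x) = 0, forall x, S x = 0 -> K x = x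
  & forall C, hsym C -> commute_op C S -> commute_op C K].
Proof.
move=> Ss [M M0 SM].
have Lsub : hsubspace [set x | S x = 0].
  split=> /= [|a x y Sx Sy]; first exact: hsym0.
  by rewrite (hsymP Ss) Sx Sy scaler0 addr0.
have Lcl : hclosed [set x | S x = 0].
  move=> x hx; apply/hnorm_eq0/eqP; rewrite eq_le hnorm_ge0 andbT.
  apply/ler_addgt0Pl => e e0; rewrite addr0.
  have [y /= Sy] := hx (e / M) (divr_gt0 e0 M0).
  rewrite ltr_pdivlMr // => xy; have := SM (x - y); rewrite (hsymB Ss) Sy subr0; lra.
have [K [Kp KL LK]] := projection_theorem Lsub Lcl.
exists K; split=> // C Cs CS x.
have -> // : commute_op K C.
by apply: hproj_commute => // z Kz; apply: LK; rewrite /= -CS -Kz KL (hsym0 Cs).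
Qed.

(** [E] is the projection onto the kernel of [|B| - B]; as
    [(|B| - B) (|B| + B) = 0], [B = - |B|] on the orthogonal complement. *)
Lemma sign_proj B : hsym B -> hbounded B -> exists E, [/\ hproj E,
  forall x, 0 <= rdot (B (E x)) (E x), forall x, E x = 0 -> rdot (B x) x <= 0
  & forall C, hsym C -> commute_op C B -> commute_op C E].
Proof.
(* Scaling makes [B1] a contraction, so that [X = 1 - B1^2] is one as well; [W = 1 - Y] will be the
   absolute value of [B1]. *)
move=> Bs [M M0 BM]; pose B1 x := (M^-1)%:C *: B x.
have B1s : hsym B1 by move=> x y; rewrite /B1 dotZl dotZr_real Bs.
have B1le x : hnorm (B1 x) <= hnorm x.
  by rewrite /B1 hnormZ gtr0_norm ?invr_gt0 // ler_pdivrMl // BM.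
have B1C C : hsym C -> commute_op C B -> commute_op C B1.
  by move=> Cs CB x; rewrite /B1 (hsymZ Cs) CB.
pose X x := x - B1 (B1 x).
have Xs : hsym X by move=> x y; rewrite /X dotBl dotBr !B1s.
have Xle x : hnorm (X x) <= hnorm x.
  rewrite -(ler_pXn2r (n := 2)) ?nnegrE ?hnorm_ge0 // /X sqr_hnormB -(hsym_rdot B1s).
  rewrite -sqr_hnorm.
  have : hnorm (B1 (B1 x)) ^+ 2 <= hnorm (B1 x) ^+ 2 by rewrite ler_pXn2r ?nnegrE ?hnorm_ge0.
  by have := sqr_ge0 (hnorm (B1 x)); lra.
have [Y [Ys Yle YE YC]] := sqrt_one_sub Xs Xle.
have XC C : hsym C -> commute_op C B -> commute_op C X.
  by move=> Cs CB x; rewrite /X (hsymB Cs) !(B1C C).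
have B1Y : commute_op B1 Y by apply: YC => // x; rewrite /X (hsymB B1s).
pose W x := x - Y x.
have Ws : hsym W by move=> x y; rewrite /W dotBl dotBr Ys.
have WW x : W (W x) = B1 (B1 x).
  rewrite /W (hsymB Ys) opprB addrA -addrA -addrA; apply/eqP.
  rewrite -subr_eq0 /=; have -> : - Y x + (Y (Y x) - Y x) = - X x.
    by rewrite addrCA -opprD YE opprD [- X x - _]addrC addrA subrr add0r.
  by rewrite /X opprB addrCA subrr addr0 subrr.
have W0 x : 0 <= rdot (W x) x.
  rewrite /W rdotBl -sqr_hnorm; have := rdot_le (Y x) x.
  have := ler_wpM2r (hnorm_ge0 x) (Yle x); lra.
pose Z x := W x - B1 x.
have Zs : hsym Z by move=> x y; rewrite /Z dotBl dotBr Ws B1s.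
have Zb : hbounded Z.
  exists 3; first by rewrite ltr0n.
  move=> x; rewrite /Z; have := hnormB (W x) (B1 x); have := hnormB x (Y x).
  rewrite -/(W x); have := Yle x; have := B1le x; lra.
have [E [Ep ZE EZ EC]] := kernel_proj Zs Zb.
have B1B x : rdot (B x) x = M * rdot (B1 x) x.
  by rewrite /B1 rdotZl mulrA divff ?mul1r // gt_eqF.
exists E; split=> // [x|x Ex|C Cs CB].
- rewrite B1B; apply: mulr_ge0; first exact: ltW.
  have /eqP := ZE x; rewrite /Z subr_eq0 => /eqP <-; exact: W0.
- suff h : W x + B1 x = 0.
    rewrite B1B; have -> : rdot (B1 x) x = - rdot (W x) x.
      by apply/eqP; rewrite -addr_eq0 addrC -rdotDl h rdot0l.
    by rewrite mulrN oppr_le0 mulr_ge0 // ltW.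
  apply: dot_nondeg => z.
  have -> : dot (W x + B1 x) z = dot x (W z + B1 z) by rewrite dotDl dotDr Ws B1s.
  rewrite -(EZ (W z + B1 z)); first by rewrite -Ep.1 Ex dot0l.
  rewrite /Z (hsymD Ws) (hsymD B1s) WW.
  have -> : W (B1 z) = B1 (W z) by rewrite /W (hsymB B1s) B1Y.
  by rewrite [X in _ - X]addrC subrr.
- apply: EC => // x; rewrite /Z /W !(hsymB Cs) (YC C Cs (XC C Cs CB)) (B1C C Cs CB) //.
Qed.

(** The lower bound makes the image of the range of [P] closed. By symmetry, a vector of that range
    orthogonal to the image lies in the kernel of [T], where the lower bound leaves only 0. *)
Lemma bounded_below_surj P T (c : R) : hproj P -> hsym T -> hbounded T ->
  commute_op P T -> 0 < c -> (forall x, P x = x -> c * hnorm x <= hnorm (T x)) ->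
  forall y, P y = y -> exists2 x, P x = x & T x = y.
Proof.
move=> [Ps PP] Ts [M M0 TM] PT c0 lb y Py.
pose L : set H := [set T x | x in [set x | P x = x]].
have Lsub : hsubspace L.
  split; first by exists 0; rewrite /= ?(hsym0 Ps) ?(hsym0 Ts).
  move=> a _ _ [u /= Pu <-] [v /= Pv <-]; exists (a *: u + v); last by rewrite (hsymP Ts).
  by rewrite /= (hsymP Ps) Pu Pv.
have Lcl : hclosed L.
  move=> v hv.
  have /choice[u hu] n : exists x, P x = x /\ hnorm (v - T x) < n.+1%:R^-1.
    by have [_ [x /= Px <-] h] := hv _ (inv_gt0 n); exists x.
  have udist m n N : (N <= m)%N -> (N <= n)%N -> c * hnorm (u m - u n) <= 2 * N.+1%:R^-1.
    move=> Nm Nn; have h : P (u m - u n) = u m - u n.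
      by rewrite (hsymB Ps) (hu m).1 (hu n).1.
    apply: (le_trans (lb _ h)); rewrite (hsymB Ts).
    have := hdistD v (T (u m)) (T (u n)); rewrite (hdistC _ v).
    have := (hu m).2; have := (hu n).2; have := inv_le Nm; have := inv_le Nn.
    move: (N.+1%:R^-1 : R) (m.+1%:R^-1 : R) (n.+1%:R^-1 : R) => i j k; lra.
  have [x hx] : exists x, hlim u x.
    apply: hcauchy => e e0.
    have [N hN] := archi_lt (divr_gt0 (mulr_gt0 c0 e0) (ltr0n R 2)).
    exists N => m n Nm Nn; rewrite -(ltr_pM2l c0); have := udist m n N Nm Nn.
    move: hN; move: (N.+1%:R^-1 : R) => i; lra.
  have eq0 z : (forall e : R, 0 < e -> hnorm z <= e) -> z = 0.
    move=> h; apply/hnorm_eq0/eqP; rewrite eq_le hnorm_ge0 andbT.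
    by apply/ler_addgt0Pl => e e0; rewrite addr0 h.
  exists x => /=.
    apply/eqP; rewrite -subr_eq0; apply/eqP/eq0 => e e0.
    have [N /(_ N (leqnn N)) hN] := hx (e / 2) (divr_gt0 e0 (ltr0n _ 2)).
    have h1 := hdistD (u N) (P x) x.
    have h2 : hnorm (P x - u N) <= hnorm (u N - x).
      by rewrite -{1}(hu N).1 -(hsymB Ps) (hdistC (u N)); exact: hproj_le.
    lra.
  apply/eqP; rewrite -subr_eq0; apply/eqP/eq0 => e e0.
  have M1 : 0 < M + 1 by lra.
  have [N hN] := hx (e / 2 / (M + 1)) (divr_gt0 (divr_gt0 e0 (ltr0n _ 2)) M1).
  have [k hk] := archi_lt (divr_gt0 e0 (ltr0n R 2)).
  have := hN _ (leq_maxl N k); rewrite ltr_pdivlMr //; have := hdistD (T (u (maxn N k))) (T x) v.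
  rewrite -(hsymB Ts) (hdistC (T (u (maxn N k))) v); have := (hu (maxn N k)).2.
  have := TM (x - u (maxn N k)); rewrite (hdistC x); have := inv_le (leq_maxr N k).
  have := hnorm_ge0 (u (maxn N k) - x).
  move: hk; move: (k.+1%:R^-1 : R) ((maxn N k).+1%:R^-1 : R) => i j; lra.
have [Q [[Qs QQ] QL LQ]] := projection_theorem Lsub Lcl.
have [x /= Px Tx] := QL y; exists x => //; rewrite Tx.
apply/eqP; rewrite -subr_eq0; apply/eqP; set z := Q y - y.
have Pz : P z = z by rewrite /z -Tx (hsymB Ps) PT Px Py.
have Tz : T z = 0.
  apply: rdot0_eq0; rewrite (hsym_rdot Ts).
  have TTz : L (T (T z)) by exists (T z) => //=; rewrite PT Pz.
  by rewrite -(LQ _ TTz) -(hsym_rdot Qs) /z (hsymB Qs) QQ subrr rdot0l.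
have := lb _ Pz; rewrite Tz hnorm0 => h; apply: hnorm_eq0.
have := hnorm_ge0 z; nra.
Qed.

(** [Q k] cuts [E] down to the spectral subspace where [|S|] is at least [1/(k+1)]: it composes [E]
    with the sign projection of [S^2 - (k+1)^-2]. *)
Lemma spectral_filtration S E : hsym S -> hbounded S -> hproj E -> commute_op E S ->
  exists Q : nat -> H -> H, [/\ forall k, hproj (Q k), forall k x, E (Q k x) = Q k x,
    forall k x, Q k.+1 (Q k x) = Q k x
  & [/\ forall k x, Q k x = x -> k.+1%:R^-1 * hnorm x <= hnorm (S x),
    forall k x, E x = x -> Q k x = 0 -> hnorm (S x) <= k.+1%:R^-1 * hnorm x
  & forall k C, hsym C -> commute_op C S -> commute_op C E -> commute_op C (Q k)]].
Proof.
move=> Ss [M M0 SM] Ep ES; pose B k x := S (S x) - ((k.+1%:R^-1) ^+ 2)%:C *: x.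
have Bs k : hsym (B k) by move=> x y; rewrite /B dotBl dotBr dotZl dotZr_real !Ss.
have Bb k : hbounded (B k).
  exists (M ^+ 2 + (k.+1%:R^-1) ^+ 2).
    by rewrite addr_gt0 // exprn_gt0 // inv_gt0.
  move=> x; apply: le_trans (hnormB _ _) _; rewrite hnormZ ger0_norm ?sqr_ge0 // mulrDl.
  rewrite lerD2r; apply: le_trans (SM _) _; rewrite expr2 -mulrA.
  by rewrite ler_wpM2l // ltW.
have BC k C : hsym C -> commute_op C S -> commute_op C (B k).
  by move=> Cs CS x; rewrite /B (hsymB Cs) (hsymZ Cs) !CS.
have BE k x : rdot (B k x) x = hnorm (S x) ^+ 2 - (k.+1%:R^-1 * hnorm x) ^+ 2.
  by rewrite /B rdotBl rdotZl (hsym_rdot Ss) -!sqr_hnorm exprMn.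
have /choice[N hN] k := sign_proj (Bs k) (Bb k).
have Np k : hproj (N k) by have [] := hN k.
have NC k C : hsym C -> commute_op C S -> commute_op C (N k).
  by move=> Cs CS; have [_ _ _] := hN k; apply=> //; apply: BC.
have EN k : commute_op E (N k) by apply: NC => //; exact: Ep.1.
have NS k : commute_op (N k) S by move=> x; rewrite (NC k S).
have NN j k : commute_op (N j) (N k) by apply: NC => //; exact: (Np j).1.
have sq_le (a b : R) : 0 <= a -> 0 <= b -> (a ^+ 2 <= b ^+ 2) = (a <= b).
  by move=> a0 b0; rewrite ler_pXn2r ?nnegrE.
have i0 k x : 0 <= k.+1%:R^-1 * hnorm x by rewrite mulr_ge0 ?hnorm_ge0 // ltW ?inv_gt0.
have lb k x : N k x = x -> k.+1%:R^-1 * hnorm x <= hnorm (S x).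
  move=> Nx; have [_ /(_ x) h _ _] := hN k; move: h.
  by rewrite Nx BE subr_ge0 sq_le ?hnorm_ge0.
have ub k x : N k x = 0 -> hnorm (S x) <= k.+1%:R^-1 * hnorm x.
  move=> Nx; have [_ _ /(_ x Nx) h _] := hN k; move: h.
  by rewrite BE subr_le0 sq_le ?hnorm_ge0.
have [Es EE] := Ep.
exists (fun k x => E (N k x)); split=> [k|k x|k x|].
- exact: hproj_comp.
- exact: EE.
- rewrite -EN EE; congr (E _); set y := N k x.
  (* The component [z] of [N k x] missed by [N k.+1] satisfies [hnorm z / (k+1) <= hnorm (S z) <=
     hnorm z / (k+2)], so it vanishes. *)
  apply/esym/eqP; rewrite -subr_eq0; apply/eqP; set z := y - _.
  have Nz : N k z = z by rewrite /z (hsymB (Np k).1) NN /y (Np k).2.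
  have Nz' : N k.+1 z = 0 by rewrite /z (hsymB (Np k.+1).1) (Np k.+1).2 subrr.
  have := le_trans (lb _ _ Nz) (ub _ _ Nz'); rewrite -subr_ge0 -mulrBl => h.
  apply: hnorm_eq0; apply/eqP; rewrite eq_le hnorm_ge0 andbT.
  have : (k.+2%:R^-1 : R) < k.+1%:R^-1 by rewrite ltf_pV2 ?posrE ?ltr0n // ltr_nat.
  by rewrite -subr_lt0 => /nmulr_rge0 <-.
- split=> [k x Qx|k x Ex Qx|k C Cs CS CE x].
  + by apply: lb; rewrite -{1}Qx -EN (Np k).2.
  + by apply: ub; rewrite -Ex -EN.
  + by rewrite CE (NC k C).
Qed.

(** * Exhaustion by reducing subspaces *)

Lemma hproj_absorb E Q : hproj E -> hproj Q -> (forall x, E (Q x) = Q x) ->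
  forall x, Q (E x) = Q x.
Proof.
move=> [Es _] [Qs _] EQ x; apply/eqP; rewrite -subr_eq0; apply/eqP/dot_nondeg => y.
by rewrite dotBl !Qs Es EQ subrr.
Qed.

(** For [e = 0] this is the zero map, so [line_projP] holds for every [e]. *)
Definition line_proj (e x : H) : H := (dot x e / dot e e) *: e.

Lemma line_projP e : hproj (line_proj e).
Proof.
have ee : (dot e e)^* = dot e e by rewrite -dotC.
split=> [x y|x]; rewrite /line_proj.
  by rewrite dotZl dotZr rmorphM fmorphV /= ee -dotC mulrAC [RHS]mulrAC (mulrC (dot x e)).
rewrite dotZl; have [->|e0] := eqVneq (dot e e) 0; last by rewrite mulfK.
by rewrite invr0 !mulr0.
Qed.

Lemma line_proj_id e : line_proj e e = e.
Proof.
rewrite /line_proj; have [e0|e0] := eqVneq (dot e e) 0; last by rewrite divff ?scale1r.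
by rewrite (_ : e = 0) ?scaler0 //; apply: rdot0_eq0; rewrite /rdot e0.
Qed.

Lemma ortho_closed (W : set H) : hclosed [set x | forall w, W w -> dot x w = 0].
Proof.
move=> x hx w Ww /=.
(* Cauchy-Schwarz passes real orthogonality to limits; applying this to [w] and ['i *: w] recovers
   the complex product. *)
have rd v : (forall y, (forall w, W w -> dot y w = 0) -> rdot y v = 0) -> rdot x v = 0.
  move=> hv; apply/eqP; rewrite -normr_eq0 eq_le normr_ge0 andbT.
  apply/ler_addgt0Pl => e e0; rewrite addr0.
  have v1 : 0 < 1 + hnorm v by rewrite ltr_pwDl ?hnorm_ge0.
  have [y /= Wy] := hx (e / (1 + hnorm v)) (divr_gt0 e0 v1).
  rewrite ltr_pdivlMr // => xy; have := rdot_norm_le (x - y) v.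
  rewrite rdotBl (hv _ Wy) subr0; have := hnorm_ge0 (x - y); lra.
by rewrite dot_rdot !rd // => y Wy; rewrite /rdot ?dotZr Wy // mulr0.
Qed.

Lemma ortho_subspace (W : set H) : hsubspace [set x | forall w, W w -> dot x w = 0].
Proof.
split=> /= [w _|a x y Wx Wy w Ww]; first exact: dot0l.
by rewrite dotDl dotZl Wx // Wy // mulr0 addr0.
Qed.

Section Exhaustion.
Variable T : H -> H.
Hypotheses (Tsym : hsym T) (Tbnd : hbounded T) (Tinj : forall x, T x = 0 -> x = 0).

(** The range of [T] stands for the domain of the unbounded inverse of [T]; the
    last clause says that the ranges of the [P k] are jointly dense in that of [E]. *)
Definition exhaustion E (P : nat -> H -> H) :=
  [/\ forall k, hproj (P k), forall k, commute_op (P k) T, forall k x, E (P k x) = P k x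
  & [/\ forall k x, P k.+1 (P k x) = P k x, forall k x, P k x = x -> exists w, T w = x
  & forall y, E y = y -> (forall k, P k y = 0) -> y = 0]].

Definition proper_in E (P : nat -> H -> H) :=
  forall k, exists u, [/\ u != 0, E u = u & P k u = 0].

Definition bounded_below_on S E :=
  exists2 c : R, 0 < c & forall x, E x = x -> c * hnorm x <= hnorm (S x).

(** If [Q k] misses no nonzero vector of the range of [E], it is the identity there, and its lower
    bound for [S] covers the whole range. *)
Lemma proper_or_bounded_below S E (Q : nat -> H -> H) : hproj E ->
  (forall k, hproj (Q k)) -> (forall k x, E (Q k x) = Q k x) ->
  (forall k x, Q k x = x -> k.+1%:R^-1 * hnorm x <= hnorm (S x)) ->
  proper_in E Q \/ bounded_below_on S E.
Proof.
move=> [Es EE] Qp EQ lb; have [|/existsNP[k hk]] := pselect (proper_in E Q); first by left.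
right; exists (k.+1%:R^-1); first exact: inv_gt0.
move=> x Ex; apply: lb; have [Qs QQ] := Qp k.
apply/eqP; rewrite -subr_eq0; apply: contra_notT hk => u0.
by exists (Q k x - x); rewrite u0 (hsymB Es) EQ Ex (hsymB Qs) QQ subrr.
Qed.

Lemma range_of_bounded_below E : hproj E -> commute_op E T -> bounded_below_on T E ->
  forall x, E x = x -> exists w, T w = x.
Proof.
move=> Ep ET [c c0 lb] x Ex.
by have [w _ Tw] := bounded_below_surj Ep Tsym Tbnd ET c0 lb Ex; exists w.
Qed.

(** The filtration by the size of [T] works: [T] is bounded below on each piece, which therefore
    lies in its range, and a vector of the range of [E] killed by every [Q k] has [T y = 0]. *)
Lemma exhaustion_exists E : hproj E -> commute_op E T ->
  exists2 P, exhaustion E P & proper_in E P \/ bounded_below_on T E.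
Proof.
move=> Ep ET; have [Q [Qp EQ QS [lb ub QC]]] := spectral_filtration Tsym Tbnd Ep ET.
have QT k : commute_op (Q k) T by move=> x; rewrite (QC k T).
exists Q; last exact: proper_or_bounded_below Ep Qp EQ lb.
split=> //; split=> [//|k x Qx|y Ey Qy].
  apply: (range_of_bounded_below (Qp k)) Qx => //.
  by exists (k.+1%:R^-1); [exact: inv_gt0|exact: lb].
apply: Tinj; apply: hnorm_eq0; apply/eqP; rewrite eq_le hnorm_ge0 andbT.
apply/ler_addgt0Pl => e e0; rewrite addr0.
have y1 : 0 < 1 + hnorm y by rewrite ltr_pwDl ?hnorm_ge0.
have [k] := archi_lt (divr_gt0 e0 y1); rewrite ltr_pdivlMr // => hk.
have := ub k y Ey (Qy k); have := inv_gt0 k; move: hk; move: (k.+1%:R^-1 : R) => i; lra.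
Qed.

(** * Exhaustion off and inside the kernel of [1 - rho T] *)

Section Eigenvalue.
Variables (rho : R) (E K : H -> H).
Let S x := x - rho%:C *: T x.
Hypotheses (Ep : hproj E) (ET : commute_op E T).
Hypothesis ran : forall x, E x = x -> exists w, T w = x.
Hypotheses (Kp : hproj K) (SK : forall x, S (K x) = 0) (KS : forall x, S x = 0 -> K x = x).
Hypothesis KC : forall C, hsym C -> commute_op C S -> commute_op C K.

Lemma shift_sym : hsym S.
Proof. by move=> x y; rewrite /S dotBl dotBr dotZl dotZr_real Tsym. Qed.

Lemma shift_bounded : hbounded S.
Proof.
have [M M0 TM] := Tbnd; exists (1 + `|rho| * M).
  by rewrite ltr_pwDl // mulr_ge0 // ltW.
move=> x; rewrite /S; have := hnormB x (rho%:C *: T x); rewrite hnormZ.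
have := ler_wpM2l (normr_ge0 rho) (TM x); lra.
Qed.

Lemma shift_commute C : hsym C -> commute_op C T -> commute_op C S.
Proof. by move=> Cs CT x; rewrite /S (hsymB Cs) (hsymZ Cs) CT. Qed.

(** The filtration is now by the size of [S], on the part of [E] orthogonal to its kernel;
    membership in the range of [T] comes from [ran]. *)
Lemma exhaustion_off_kernel : (exists2 P, exhaustion E P & proper_in E P) \/
  bounded_below_on S (fun x => E (x - K x)).
Proof.
have [Es EE] := Ep; have [Ks KK] := Kp.
have EK : commute_op E K by apply: KC => //; exact: shift_commute.
have TK : commute_op T K by apply: KC => //; exact: shift_commute.
have KcP := hproj_compl Kp.
have EKc : commute_op E (fun x => x - K x) by move=> x /=; rewrite (hsymB Es) EK.
pose E' x := E (x - K x).
have E'p : hproj E' by exact: hproj_comp.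
have E'T : commute_op E' T by move=> x; rewrite /E' -TK -(hsymB Tsym) ET.
have E'S : commute_op E' S by apply: shift_commute => //; exact: E'p.1.
have [Q [Qp EQ QS [lb ub QC]]] := spectral_filtration shift_sym shift_bounded E'p E'S.
have [prop|bb] := proper_or_bounded_below E'p Qp EQ lb; last by right.
left; have EKp := hproj_comp Ep Kp EK.
have QE' k := hproj_absorb E'p (Qp k) (EQ k).
have QEK k x : Q k (E (K x)) = 0.
  by rewrite -QE' /E' -(EK (K x)) KK subrr (hsym0 Es) (hsym0 (Qp k).1).
have KQ k x : K (Q k x) = 0.
  by rewrite -EQ /E' -EK (hsymB Ks) KK subrr (hsym0 Es).
have EQ' k x : E (Q k x) = Q k x by rewrite -EQ /E' EE.
have QT k : commute_op (Q k) T.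
  by move=> x; rewrite (QC k T) //; exact: shift_commute.
(* The kernel part is put back at every stage, since all [Q k] annihilate it. *)
exists (fun k x => Q k x + E (K x)).
  split=> [k|k x|k x|].
  - exact: hproj_add.
  - by rewrite QT -TK ET (hsymD Tsym).
  - by rewrite (hsymD Es) EQ' EE.
  - split=> [k x|k x Px|y Ey Py].
    + rewrite (hsymD (Qp k.+1).1) QS QEK addr0 (hsymD Ks) KQ add0r.
      by rewrite -EK EE KK.
    + by apply: ran; rewrite -Px (hsymD Es) EQ' EE.
    + have Ky : K y = 0.
        have := congr1 K (Py 0%N).
        by rewrite (hsymD Ks) KQ add0r (hsym0 Ks) -EK KK EK Ey.
      have Qy k : Q k y = 0 by have := Py k; rewrite Ky (hsym0 Es) addr0.
      have E'y : E' y = y by rewrite /E' Ky subr0.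
      rewrite -Ky; apply/esym/KS/hnorm_eq0/eqP; rewrite eq_le hnorm_ge0 andbT.
      apply/ler_addgt0Pl => e e0; rewrite addr0.
      have y1 : 0 < 1 + hnorm y by rewrite ltr_pwDl ?hnorm_ge0.
      have [k] := archi_lt (divr_gt0 e0 y1); rewrite ltr_pdivlMr // => hk.
      have := ub k y E'y (Qy k); have := inv_gt0 k.
      by move: hk; move: (k.+1%:R^-1 : R) => i; lra.
move=> k; have [u [u0 E'u Qu]] := prop k; exists u; split=> //.
  by rewrite -E'u /E' EE.
rewrite Qu add0r -E'u /E' -EK EE EK.
by rewrite -EK (hsymB Ks) KK subrr (hsym0 Es).
Qed.

Hypothesis EK : forall x, E (K x) = K x.
Hypothesis Kinf : ~ exists s : seq H, forall x, K x = x ->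
  exists c : nat -> R[i], x = \sum_(i < size s) c i *: s`_i.

Let pick (F : H -> H) : H := xget 0 [set e | F e = e /\ e != 0].

(** Gram-Schmidt without a given basis: [gs_proj n] projects onto the vectors of the range of [K]
    orthogonal to the first [n] picks. *)
Fixpoint gs_proj n : H -> H :=
  if n is m.+1 then fun x => gs_proj m (x - line_proj (pick (gs_proj m)) x) else K.

Let vec n := pick (gs_proj n).

Lemma gs_vec n : hproj (gs_proj n) -> gs_proj n (vec n) = vec n.
Proof.
move=> Fp; rewrite /vec /pick; case: xgetP => [e _ [] //|_]; exact: hsym0 Fp.1.
Qed.

Lemma gs_line n : hproj (gs_proj n) ->
  commute_op (gs_proj n) (line_proj (vec n)).
Proof.
move=> Fp x; have [Fs FF] := Fp; rewrite /line_proj (hsymZ Fs) gs_vec //.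
by rewrite Fs gs_vec.
Qed.

Lemma gs_projP n : hproj (gs_proj n).
Proof.
elim: n => [//|n IH] /=; apply: hproj_comp => //.
  exact: hproj_compl (line_projP _).
by move=> x /=; rewrite (hsymB IH.1) gs_line.
Qed.

Lemma gs_projS n x : gs_proj n.+1 x = gs_proj n x - line_proj (vec n) x.
Proof.
rewrite /= (hsymB (gs_projP n).1); congr (_ - _).
by rewrite /line_proj (hsymZ (gs_projP n).1) (gs_vec (gs_projP n)).
Qed.

Lemma gs_proj_le m n x : (m <= n)%N -> gs_proj m (gs_proj n x) = gs_proj n x.
Proof.
move=> /subnKC <-; elim: (n - m)%N x => [|k IH] x; first by rewrite addn0 (gs_projP m).2.
by rewrite addnS /= IH.
Qed.

Lemma gs_vec_ortho i j : (j < i)%N -> dot (vec j) (vec i) = 0.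
Proof.
move=> ji; rewrite -[vec i](gs_vec (gs_projP i)) -(gs_proj_le _ ji) -(gs_projP _).1.
by rewrite gs_projS (gs_vec (gs_projP j)) line_proj_id subrr dot0l.
Qed.

Lemma gs_vec_kernel n : K (vec n) = vec n.
Proof. by have := gs_proj_le (vec n) (leq0n n); rewrite (gs_vec (gs_projP n)). Qed.

(** A zero pick is the default of [pick] and means [gs_proj n = 0]; the first [n] vectors then span
    the range of [K], against [Kinf]. *)
Lemma gs_vec_neq0 n : vec n != 0.
Proof.
apply: contra_notT Kinf => /negPn/eqP v0; exists (mkseq vec n) => x Kx.
have sum m : K x - gs_proj m x = \sum_(i < m) (dot x (vec i) / dot (vec i) (vec i)) *: vec i.
  elim: m => [|m IH]; first by rewrite big_ord0 subrr.
  by rewrite big_ord_recr -IH gs_projS opprB addrA addrAC.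
exists (fun i => dot x (vec i) / dot (vec i) (vec i)).
have Fx : gs_proj n x = 0.
  move: v0; rewrite /vec /pick; case: xgetP => [e _ [_ /eqP e0] //|h _].
  apply: contra_notP (h (gs_proj n x)) => /eqP Fx0; split=> //; exact: (gs_projP n).2.
transitivity (K x - gs_proj n x); first by rewrite Fx subr0 Kx.
rewrite sum size_mkseq; apply: eq_bigr => i _.
by rewrite nth_mkseq.
Qed.

(** The orthogonal complements of the tails of [vec] increase to a dense union, yet the [k]-th one
    omits [vec k]. As [T] is scalar on the family, each complement reduces [T]. *)
Lemma exhaustion_in_kernel (a : R[i]) : (forall x, K x = x -> T x = a *: x) ->
  exists2 P, exhaustion E P & proper_in E P.
Proof.
move=> TK; pose W k : set H := [set vec j | j in [set j | (k <= j)%N]].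
pose L k : set H := [set x | forall w, W k w -> dot x w = 0].
have LP k x : L k x <-> forall j, (k <= j)%N -> dot x (vec j) = 0.
  by split=> [h j kj|h _ [j /= kj <-]]; apply: h => //; exists j.
have /choice[D hD] k := projection_theorem (ortho_subspace _) (@ortho_closed (W k)).
have Dp k : hproj (D k) by have [] := hD k.
have DL k x j : (k <= j)%N -> dot (D k x) (vec j) = 0.
  by have [_ h _] := hD k; move: (h x) => /LP; apply.
have LD k x : (forall j, (k <= j)%N -> dot x (vec j) = 0) -> D k x = x.
  by have [_ _ h] := hD k; move=> /LP; exact: h.
have DT k : commute_op (D k) T.
  apply: hproj_commute => // x Dx; apply: LD => j kj.
  by rewrite Tsym TK ?gs_vec_kernel // dotZr -Dx DL // mulr0.
have DE k : commute_op (D k) E.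
  apply: hproj_commute => //; first exact: Ep.1.
  by move=> x Dx; apply: LD => j kj; rewrite Ep.1 -gs_vec_kernel EK gs_vec_kernel -Dx DL.
have [Es EE] := Ep.
exists (fun k x => E (D k x)).
  split=> [k|k x|k x|].
  - by apply: hproj_comp => // x; rewrite DE.
  - by rewrite DT ET.
  - exact: EE.
  - split=> [k x|k x Px|y Ey Py].
    + rewrite DE EE; congr (E _); apply: LD => j kj; apply: DL; exact: ltnW.
    + by apply: ran; rewrite -Px EE.
    + have Dy k : D k y = 0 by rewrite -[y]Ey DE.
      rewrite -(Dy 0%N); apply/esym/LD => j _.
      have <- : D j.+1 (vec j) = vec j by apply: LD => i ji; exact: gs_vec_ortho.
      by rewrite -(Dp _).1 Dy dot0l.
move=> k; exists (vec k); split; first exact: gs_vec_neq0.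
  by rewrite -gs_vec_kernel EK.
suff -> : D k (vec k) = 0 by exact: hsym0.
apply: dot_nondeg => z; rewrite (Dp k).1; apply: dot_eq0C; exact: DL.
Qed.

End Eigenvalue.
End Exhaustion.

(** * Increasing sequences of projections and isotropic vectors *)

Lemma increasing_hproj_le (Q : nat -> H -> H) m n x : (forall k, hproj (Q k)) ->
  (forall k x, Q k.+1 (Q k x) = Q k x) -> (m <= n)%N -> Q n (Q m x) = Q m x.
Proof.
move=> Qp QS /subnKC <-; elim: (n - m)%N => [|k IH]; first by rewrite addn0 (Qp m).2.
by rewrite addnS -IH QS.
Qed.

Lemma increasing_hproj_ge (Q : nat -> H -> H) m n x : (forall k, hproj (Q k)) ->
  (forall k x, Q k.+1 (Q k x) = Q k x) -> (m <= n)%N -> Q m (Q n x) = Q m x.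
Proof.
move=> Qp QS mn; apply: (hproj_absorb (Qp n) (Qp m)) => w.
exact: increasing_hproj_le.
Qed.

(** By Pythagoras the squared distances between the [Q n x] are differences of the bounded
    increasing sequence [hnorm (Q n x) ^+ 2], so a limit exists; every [Q k] kills [x] minus that
    limit. *)
Lemma hproj_increasing_cvg (Q : nat -> H -> H) x : (forall k, hproj (Q k)) ->
  (forall k x, Q k.+1 (Q k x) = Q k x) ->
  (forall y, (forall k, Q k y = 0) -> y = 0) -> hlim (fun k => Q k x) x.
Proof.
move=> Qp QS Q0.
have Qge m n z : (m <= n)%N -> Q m (Q n z) = Q m z by exact: increasing_hproj_ge.
have dist m n : (m <= n)%N ->
    hnorm (Q n x - Q m x) ^+ 2 = hnorm (Q n x) ^+ 2 - hnorm (Q m x) ^+ 2.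
  by move=> mn; have := pythagoras (Q n x) (Qp m); rewrite Qge //; lra.
pose D : set R := range (fun n => hnorm (Q n x) ^+ 2).
have hD : has_sup D.
  split; first by exists (hnorm (Q 0%N x) ^+ 2), 0%N.
  exists (hnorm x ^+ 2) => _ [n _ <-].
  by rewrite ler_pXn2r ?nnegrE ?hnorm_ge0 //; exact: hproj_le.
have [p hp] : exists p, hlim (fun k => Q k x) p.
  apply: hcauchy => e e0; have e2 : 0 < e ^+ 2 by rewrite exprn_gt0.
  have [_ [N _ <-] hN] := sup_adherent e2 hD.
  have h m n : (N <= m)%N -> (m <= n)%N -> hnorm (Q n x - Q m x) < e.
    move=> Nm mn; rewrite -(ltr_pXn2r (n := 2)) ?nnegrE ?hnorm_ge0 ?(ltW e0) //.
    rewrite dist //.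
    have : hnorm (Q n x) ^+ 2 <= sup D by apply: ub_le_sup; [case: hD|exists n].
    by have := dist N m Nm; have := sqr_ge0 (hnorm (Q m x - Q N x)); lra.
  exists N => m n Nm Nn; case/orP: (leq_total n m) => nm; first exact: h.
  by rewrite hdistC; apply: h.
suff : x - p = 0 by move/eqP; rewrite subr_eq0 => /eqP {2}->.
apply: Q0 => k; apply/hnorm_eq0/eqP; rewrite eq_le hnorm_ge0 andbT.
apply/ler_addgt0Pl => e e0; rewrite addr0; have [N hN] := hp e e0.
have := hN _ (leq_maxl N k); set n := maxn N k => hn; have kn : (k <= n)%N by exact: leq_maxr.
have -> : Q k (x - p) = Q k (Q n x - p) by rewrite !(hsymB (Qp k).1) Qge.
exact: le_trans (hproj_le _ (Qp k)) (ltW hn).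
Qed.

Lemma orthoproj_hproj P x : hproj P -> orthoproj dot [set x | P x = x] x = P x.
Proof.
move=> [Ps PP]; apply: xget_subset1.
  by split=> [|y /= Py]; [exact: PP|rewrite -Py dotBl -!Ps PP subrr].
move=> p q [/= Pp hp] [/= Pq hq]; apply/eqP; rewrite -subr_eq0; apply/eqP/rdot0_eq0.
have Ppq : P (p - q) = p - q by rewrite (hsymB Ps) Pp Pq.
rewrite {1}(_ : p - q = x - q - (x - p)); last by rewrite opprB [RHS]addrC addrA subrK.
by rewrite /rdot dotBl hq // hp // subrr.
Qed.

Lemma dot_sym_real T x : hsym T -> dot (T x) x = (rdot (T x) x)%:C.
Proof.
move=> Ts; have : dot (T x) x = (dot (T x) x)^* by rewrite -dotC Ts.
rewrite /rdot; case: (dot (T x) x) => u v [] vv.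
suff -> : v = 0 by [].
lra.
Qed.

(** Since [E] reduces [S], Pythagoras applies to [x] and to [S x] with matching components. *)
Lemma bounded_below_glue E S (c d : R) : hproj E -> hsym S -> commute_op E S ->
  0 < c -> 0 < d -> (forall x, E x = x -> c * hnorm x <= hnorm (S x)) ->
  (forall x, E x = 0 -> d * hnorm x <= hnorm (S x)) ->
  forall x, Num.min c d * hnorm x <= hnorm (S x).
Proof.
move=> Ep Ss ES c0 d0 hc hd x; set m := Num.min c d.
have m0 : 0 < m by rewrite lt_min c0.
have [mc md] : m <= c /\ m <= d by rewrite /m; split; rewrite ge_min lexx ?orbT.
have [Es EE] := Ep.
rewrite -(ler_pXn2r (n := 2)) ?nnegrE ?hnorm_ge0 ?mulr_ge0 ?hnorm_ge0 ?(ltW m0) //.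
rewrite exprMn (pythagoras x Ep) (pythagoras (S x) Ep) ES -(hsymB Ss) mulrDr -!exprMn.
have lift (a : R) y : m <= a -> a * hnorm y <= hnorm (S y) ->
    (m * hnorm y) ^+ 2 <= hnorm (S y) ^+ 2.
  move=> ma h; rewrite ler_pXn2r ?nnegrE ?hnorm_ge0 ?mulr_ge0 ?hnorm_ge0 ?(ltW m0) //.
  by apply: le_trans h; rewrite ler_wpM2r ?hnorm_ge0.
apply: lerD; first by apply: (lift c) => //; exact/hc/EE.
by apply: (lift d) => //; apply: hd; rewrite (hsymB Es) EE subrr.
Qed.

(** [E] and [1 - E] are spectral subspaces on which [T] has opposite signs, so
    vectors outside [P k] from both combine to an isotropic vector of [T]. *)
Lemma isotropic_vectors T E (P P' : nat -> H -> H) : hsym T -> hproj E -> commute_op E T ->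
  (forall x, 0 <= rdot (T (E x)) (E x)) -> (forall x, E x = 0 -> rdot (T x) x <= 0) ->
  exhaustion T E P -> proper_in E P ->
  exhaustion T (fun x => x - E x) P' -> proper_in (fun x => x - E x) P' ->
  exists Q : nat -> H -> H, [/\ forall k, hproj (Q k), forall k, commute_op (Q k) T,
    forall k x, Q k.+1 (Q k x) = Q k x
  & [/\ forall k x, Q k x = x -> exists w, T w = x,
        forall y, (forall k, Q k y = 0) -> y = 0
      & forall k, exists m y, [/\ (k < m)%N, y != 0, Q m y = y, Q k y = 0
                                & rdot (T y) y = 0]]].
Proof.
move=> Ts Ep ET Tpos Tneg [Pp PT EP [PS Pran P0]] prP [P'p P'T EP' [P'S P'ran P'0]] prP'.
have [Es EE] := Ep.
have PE k x : P k (E x) = P k x by apply: (hproj_absorb Ep (Pp k)).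
have P'E k x : P' k (x - E x) = P' k x by apply: (hproj_absorb (hproj_compl Ep) (P'p k)).
have EP'0 k x : E (P' k x) = 0 by rewrite -EP' (hsymB Es) EE subrr.
have PP' k j x : P k (P' j x) = 0 by rewrite -PE EP'0 (hsym0 (Pp k).1).
have P'P k j x : P' k (P j x) = 0.
  by rewrite -P'E EP subrr (hsym0 (P'p k).1).
pose Q k x := P k x + P' k x.
have Qp k : hproj (Q k) by exact: hproj_add.
have QS k x : Q k.+1 (Q k x) = Q k x.
  by rewrite /Q (hsymD (Pp _).1) (hsymD (P'p _).1) PS P'S PP' P'P addr0 add0r.
have QT k : commute_op (Q k) T by move=> x; rewrite /Q PT P'T (hsymD Ts).
have EQ k x : E (Q k x) = Q k (E x).
  rewrite /Q (hsymD Es) EP EP'0 PE -[P' k (E x)]P'E EE subrr (hsym0 (P'p k).1) //.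
have Qge m n z : (m <= n)%N -> Q m (Q n z) = Q m z by exact: increasing_hproj_ge.
have Q0 y : (forall k, Q k y = 0) -> y = 0.
  move=> Qy.
  have Ey : E y = 0.
    apply: P0 => [|k]; first exact: EE.
    have := congr1 (P k) (Qy k); rewrite /Q (hsymD (Pp k).1) (Pp k).2 PP' addr0 PE.
    by rewrite (hsym0 (Pp k).1).
  apply: P'0 => [|k]; first by rewrite Ey subr0.
  by have := Qy k; rewrite /Q -PE Ey (hsym0 (Pp k).1) add0r.
exists Q; split=> //; split=> // [k x Qx|k].
  have [w Tw] := Pran k (P k x) ((Pp k).2 x).
  have [w' Tw'] := P'ran k (P' k x) ((P'p k).2 x).
  by exists (w + w'); rewrite (hsymD Ts) Tw Tw'.
have nonzero u : u != 0 -> exists m, Q m u != 0.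
  move=> u0; apply: contrapT => h; move/eqP: u0; apply; apply: Q0 => j.
  by apply/eqP; apply: contra_notT h => ?; exists j.
have [u [u0 Eu Pu]] := prP k; have [v [v0 Ev P'v]] := prP' k.
have [mu Qu] := nonzero u u0; have [mv Qv] := nonzero v v0.
have {}Ev : E v = 0 by rewrite -Ev (hsymB Es) EE subrr.
have Qku : Q k u = 0 by rewrite /Q Pu -P'E Eu subrr (hsym0 (P'p k).1) addr0.
have Qkv : Q k v = 0 by rewrite /Q P'v -PE Ev (hsym0 (Pp k).1) addr0.
(* Large enough for [Q m] to keep nonzero parts of both [u] and [v]. *)
pose m := maxn k.+1 (maxn mu mv).
have km : (k < m)%N by exact: leq_maxl.
have mum : (mu <= m)%N by rewrite /m !leq_max leqnn ?orbT.
have mvm : (mv <= m)%N by rewrite /m !leq_max leqnn ?orbT.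
have nz z j : (j <= m)%N -> Q j z != 0 -> Q m z != 0.
  by move=> jm; apply: contra_neq => Qz; rewrite -(Qge _ _ _ jm) Qz (hsym0 (Qp j).1).
have {}Qu := nz u mu mum Qu; have {}Qv := nz v mv mvm Qv.
have Ea : E (Q m u) = Q m u by rewrite EQ Eu.
have Eb : E (Q m v) = 0 by rewrite EQ Ev (hsym0 (Qp m).1).
have Qka : Q k (Q m u) = 0 by rewrite Qge // ltnW.
have Qkb : Q k (Q m v) = 0 by rewrite Qge // ltnW.
move: (Q m u) (Q m v) ((Qp m).2 u) ((Qp m).2 v) Qu Qv Ea Eb Qka Qkb.
move=> a b Qa Qb a0 b0 Ea Eb Qka Qkb.
exists m; have [Tb|Tb] := eqVneq (rdot (T b) b) 0; first by exists b.
have ta : 0 <= rdot (T a) a by have := Tpos a; rewrite Ea.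
have tb : rdot (T b) b < 0 by rewrite lt_neqAle Tb Tneg.
have tab : rdot (T a) b = 0.
  by rewrite -Ea -ET (hsym_rdot Es) Eb rdotC rdot0l.
(* Cross terms vanish because [E] commutes with [T]; this [r] solves
   [rdot (T a) a + r^2 * rdot (T b) b = 0]. *)
pose r := Num.sqrt (rdot (T a) a / - rdot (T b) b).
have r2 : r ^+ 2 = rdot (T a) a / - rdot (T b) b.
  by rewrite sqr_sqrtr // divr_ge0 // oppr_ge0 ltW.
exists (a + r%:C *: b); split=> //.
- apply: contra_neq a0 => h; have := congr1 E h.
  by rewrite (hsymD Es) (hsymZ Es) Ea Eb scaler0 addr0 (hsym0 Es).
- by rewrite (hsymD (Qp m).1) (hsymZ (Qp m).1) Qa Qb.
- by rewrite (hsymD (Qp k).1) (hsymZ (Qp k).1) Qka Qkb scaler0 addr0.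
- rewrite (hsymD Ts) (hsymZ Ts) !rdotDl !rdotDr !rdotZl !rdotZr.
  rewrite (hsym_rdot Ts b a) (rdotC b) tab.
  have -> : r * (r * rdot (T b) b) = r ^+ 2 * rdot (T b) b by ring.
  by rewrite r2; field.
Qed.

(** * Compressions, resolvents and essential spectrum of [A] *)

Section Operator.
Variable A : operator H.

(** A bounded inverse of the compression minus [l] would send 0 to the eigenvector [x], while its
    bound forces 0 to go to 0. *)
Lemma increasing_Lambda (l : R) (Q : nat -> H -> H) : (forall k, hproj (Q k)) ->
  (forall k x, Q k.+1 (Q k x) = Q k x) ->
  (forall y, (forall k, Q k y = 0) -> y = 0) ->
  (forall k x, Q k x = x -> dom A x) ->
  (forall k, exists x, [/\ x != 0, Q k x = x & Q k (A x) = l%:C *: x]) ->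
  exists L : nat -> set H, [/\ Lambda dot A L, forall k : nat, L k `<=` L k.+1
    & forall k : nat, (EFin @` Spec_in dot A (L k)) l%:E].
Proof.
move=> Qp QS Q0 Qdom Qx; exists (fun k => [set x | Q k x = x]); split.
- split=> [k|x]; last first.
    under eq_cvg do rewrite orthoproj_hproj //.
    exact/hlimP/hproj_increasing_cvg.
  split; last exact: Qdom.
  have [Qs QQ] := Qp k; split.
    split; first by rewrite inE /= (hsym0 Qs).
    by move=> a x y; rewrite !inE /= => Qx' Qy; rewrite (hsymP Qs) Qx' Qy.
  apply: hclosedP => x hx /=; apply/eqP; rewrite -subr_eq0 -normr_eq0 normE.
  apply/eqP; congr (_%:C); apply/eqP; rewrite eq_le hnorm_ge0 andbT.
  apply/ler_addgt0Pl => e e0; rewrite addr0.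
  have [y /= Qy] := hx (e / 2) (divr_gt0 e0 (ltr0n _ 2)).
  have := hdistD y (Q k x) x; rewrite -{1}Qy -(hsymB Qs) (hdistC y).
  have := hproj_le (x - y) (Qp k); lra.
- by move=> k x /= Qkx; rewrite -Qkx QS.
- move=> k; exists l => // -[V [_ VT [M VM]]].
  have [x [x0 Qkx QAx]] := Qx k.
  have /= := VT x Qkx; rewrite orthoproj_hproj // QAx subrr => V0.
  have := VM 0 (hsym0 (Qp k).1); rewrite V0 normr0 mulr0 normr_le0.
  by rewrite (negbTE x0).
Qed.

Hypothesis HA : self_adjoint dot A.

Lemma self_adjoint_sym x y : dom A x -> dom A y -> dot (A x) y = dot x (A y).
Proof.
move=> Ax Ay; have [_ gr] := HA.
have : graph A (y, A y) by [].
by rewrite gr => /(_ x Ax).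
Qed.

Lemma resolvent_real (m : R) : ~ Spec A m -> exists T, [/\ hsym T, hbounded T,
  forall x, T x = 0 -> x = 0,
  forall y, dom A (T y) /\ A (T y) = m%:C *: T y + y
  & forall x, dom A x -> T (A x - m%:C *: x) = x].
Proof.
move=> /contrapT[T [T1 T2 [M TM]]].
have T3 y : dom A (T y) /\ A (T y) = m%:C *: T y + y.
  by have [? h] := T1 y I; split=> //; rewrite -[X in _ + X]h addrC subrK.
have Ts : hsym T.
  move=> x y; have [dx ex] := T3 x; have [dy ey] := T3 y.
  have := self_adjoint_sym dx dy; rewrite ex ey dotDl dotDr dotZl dotZr_real.
  by move/addrI => ->.
exists T; split=> //.
  exists (`|M| + 1); first by rewrite ltr_wpDl.
  move=> x; have := TM x I; rewrite !normE -rmorphM /= lecR => h.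
  by have := ler_norm M; have := hnorm_ge0 x; nra.
have [_ A0] := T3 0; rewrite (hsym0 Ts) scaler0 addr0 in A0.
by move=> x Tx; have [_] := T3 x; rewrite Tx scaler0 add0r A0.
Qed.

Section Resolvent.
Variables (m : R) (T : H -> H).
Hypotheses (Ts : hsym T) (Tb : hbounded T) (Tinj : forall x, T x = 0 -> x = 0).
Hypothesis AT : forall y, dom A (T y) /\ A (T y) = m%:C *: T y + y.
Hypothesis TA : forall x, dom A x -> T (A x - m%:C *: x) = x.

(** As [A - m - rho = (1 - rho T) (A - m)], bounds on [1 - rho T] give points
    of the resolvent set. *)
Lemma shift_resolvent (rho c : R) : 0 < c ->
  (forall x, c * hnorm x <= hnorm (x - rho%:C *: T x)) -> ~ Spec A (m + rho).
Proof.
move=> c0 lb; pose S x := x - rho%:C *: T x.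
have Ss : hsym S by exact: shift_sym.
have [M M0 TM] := Tb.
have Sinj x y : S x = S y -> x = y.
  move=> Sxy; apply/eqP; rewrite -subr_eq0; apply/eqP/hnorm_eq0/eqP.
  rewrite eq_le hnorm_ge0 andbT -(ler_pM2l c0) mulr0; apply: le_trans (lb _) _.
  by rewrite -/(S _) (hsymB Ss) Sxy subrr hnorm0.
have /choice[V SV] y : exists x, S x = y.
  have [//|x _ Sx] :=
    bounded_below_surj hproj_id Ss (shift_bounded Tb rho) _ c0 (fun x _ => lb x) (erefl y).
  by exists x.
have split_op x : (m + rho)%:C *: x = m%:C *: x + rho%:C *: x by rewrite rmorphD /= scalerDl.
apply; exists (fun y => V (T y)); split=> [y _|x dx|].
(* The equation [x = T (y + rho x)] puts [x] in the domain of [A]. *)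
- set x := V (T y); have ex : x = T (y + rho%:C *: x).
    by rewrite (hsymD Ts) (hsymZ Ts) -[T y]SV -/x /S subrK.
  have [dx Ax] := AT (y + rho%:C *: x); rewrite -ex in dx Ax; split=> //.
  by rewrite Ax split_op addrCA addrK.
- apply: Sinj; rewrite SV split_op opprD addrA (hsymB Ts) (hsymZ Ts).
  by rewrite TA.
- exists (c^-1 * M) => y _; rewrite !normE -rmorphM /= lecR -mulrA.
  by rewrite ler_pdivlMl //; apply: le_trans (TM y); rewrite -{2}[T y]SV lb.
Qed.

(** Three sources are tried in turn: the filtration by [T], the filtration by [1 - rho T] off its
    kernel, and an infinite-dimensional kernel. If all fail, [m + rho] is an isolated eigenvalue of
    finite multiplicity, against [ess]. *)
Lemma exhaustion_finite (rho : R) E : rho != 0 ->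
  ext_Spec_ess dot A (m + rho)%:E -> hproj E -> commute_op E T ->
  (forall x, E x = 0 -> rho * rdot (T x) x <= 0) ->
  exists2 P, exhaustion T E P & proper_in E P.
Proof.
move=> rho0 [spec ess] Ep ET neg; have [Es EE] := Ep.
have {spec}spec : Spec A (m + rho).
  by case: spec => [[[r sr [<-]]|[]]|[]].
have [P exP [prP|bbT]] := exhaustion_exists Ts Tb Tinj Ep ET; first by exists P.
have ran := range_of_bounded_below Ts Tb Ep ET bbT.
pose S x := x - rho%:C *: T x.
have Ss : hsym S by exact: shift_sym.
have Sb : hbounded S by exact: shift_bounded.
have [K [Kp SK KS KC]] := kernel_proj Ss Sb; have [Ks KK] := Kp.
have Scomm C : hsym C -> commute_op C T -> commute_op C S by exact: shift_commute.
have EK : commute_op E K by apply: KC => //; exact: Scomm.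
have TK : commute_op T K by apply: KC => //; exact: Scomm.
have [//|[c' c'0 lb]] := exhaustion_off_kernel Ts Tb Ep ET ran Kp KS KC.
(* The sign condition gives [hnorm x ^+ 2 <= rdot (S x) x], and Cauchy-Schwarz does the rest. In
   particular the kernel of [S] lies in the range of [E]. *)
have lbE x : E x = 0 -> 1 * hnorm x <= hnorm (S x).
  move=> Ex; rewrite mul1r; have [->|x0] := eqVneq x 0; first by rewrite hnorm0 hnorm_ge0.
  have hx : 0 < hnorm x.
    by rewrite lt_def hnorm_ge0 andbT; apply: contra_neq x0; exact: hnorm_eq0.
  rewrite -(ler_pM2r hx) -expr2 sqr_hnorm; apply: le_trans (rdot_le _ _).
  by rewrite /S rdotBl rdotZl; have := neg x Ex; lra.
have EKK x : E (K x) = K x.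
  apply/esym/eqP; rewrite -subr_eq0; apply/eqP/hnorm_eq0/eqP; rewrite eq_le hnorm_ge0 andbT.
  have := lbE (K x - E (K x)); rewrite (hsymB Es) EE subrr => /(_ erefl); rewrite mul1r.
  by rewrite (hsymB Ss) SK -(Scomm E Es ET) SK (hsym0 Es) subrr hnorm0.
set c1 := Num.min c' 1.
have c10 : 0 < c1 by rewrite lt_min c'0 ltr01.
have lbK x : K x = 0 -> c1 * hnorm x <= hnorm (S x).
  pose E1 x := E (x - K x).
  have E1p : hproj E1.
    apply: (hproj_comp Ep (hproj_compl Kp)) => y /=.
    by rewrite (hsymB Es) EK.
  have E1S : commute_op E1 S.
    apply: Scomm => [|y]; first exact: E1p.1.
    by rewrite /E1 -TK -(hsymB Ts) ET.
  move=> Kx; have pyth := pythagoras (S x) Ep.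
  have -> : S x = S (x - E1 x) + S (E1 x) by rewrite -(hsymD Ss) subrK.
  have e1 : E1 x = E x by rewrite /E1 Kx subr0.
  rewrite e1 -(hsymD Ss) subrK.
  have h1 : (c1 * hnorm (E x)) ^+ 2 <= hnorm (S (E x)) ^+ 2.
    rewrite ler_pXn2r ?nnegrE ?mulr_ge0 ?hnorm_ge0 ?(ltW c10) //.
    apply: le_trans (lb _ _); first by rewrite ler_wpM2r ?hnorm_ge0 // ge_min lexx.
    by rewrite -EK Kx (hsym0 Es) subr0 EE.
  have h2 : (c1 * hnorm (x - E x)) ^+ 2 <= hnorm (S (x - E x)) ^+ 2.
    rewrite ler_pXn2r ?nnegrE ?mulr_ge0 ?hnorm_ge0 ?(ltW c10) //.
    apply: le_trans (lbE _ _); first by rewrite ler_wpM2r ?hnorm_ge0 // ge_min lexx orbT.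
    by rewrite (hsymB Es) EE subrr.
  rewrite -(ler_pXn2r (n := 2)) ?nnegrE ?mulr_ge0 ?hnorm_ge0 ?(ltW c10) //.
  rewrite exprMn (pythagoras x Ep) pyth (Scomm E Es ET) -(hsymB Ss) mulrDr -!exprMn.
  exact: lerD.
have TKx x : K x = x -> T x = (rho^-1)%:C *: x.
  move=> Kx; have /eqP := SK x; rewrite Kx /S subr_eq0 => /eqP h.
  by rewrite {2}h scalerA -rmorphM /= mulVf // scale1r.
have eigK x : Defs.eigenspace A (m + rho) x -> K x = x.
  move=> [dx Ax]; apply: KS; rewrite /S -{1}(TA dx) Ax rmorphD /= scalerDl.
  by rewrite (addrAC (m%:C *: x)) subrr add0r (hsymZ Ts) subrr.
apply: (exhaustion_in_kernel Ts Ep ET ran Kp EKK _ TKx) => -[s hs].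
apply: ess; exists (m + rho) => //; split; last first.
- by exists s => x /eigK; exact: hs.
(* With a zero kernel, [S] would be bounded below everywhere and [m + rho] would be in the resolvent
   set. *)
- have [x Kx x0] : exists2 x, K x = x & x != 0.
    apply: contrapT => nK; apply: (shift_resolvent c10 _ spec) => x.
    apply: lbK; apply/eqP; apply: contra_notT nK => Kx0; exists (K x) => //.
  exists x => //; have e : x = T (rho%:C *: x).
    by rewrite (hsymZ Ts) (TKx _ Kx) scalerA -rmorphM /= mulfV // scale1r.
  have [dx Ax] := AT (rho%:C *: x); rewrite -e in dx Ax; split=> //.
  by rewrite Ax rmorphD scalerDl.
split; first by rewrite inE.
have [M M0 TM] := Tb.
(* For [|tau| <= d], the perturbation [tau T] costs at most half of the lower bound of [S] off its
   kernel. *)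
pose d := c1 / 2 / M.
have d0 : 0 < d by rewrite !divr_gt0.
exists (ball (m + rho) d); first exact: nbhsx_ballx.
apply/seteqP; split=> [r [br sr]|_ ->] /=; last by split=> //; exact: ballxx.
apply: contrapT => rne; move: br; rewrite -ball_normE /= => br.
have tau0 : r - (m + rho) != 0 by rewrite subr_eq0; apply/eqP.
set tau := r - (m + rho) in tau0.
have e : r = m + (rho + tau) by rewrite /tau; ring.
(* On the kernel of [S], [1 - (rho + tau) T] is the nonzero scalar [- tau / rho]; off it, half the
   bound of [S] survives. *)
rewrite e in sr; apply: (@shift_resolvent (rho + tau) (Num.min `|tau / rho| (c1 / 2))) sr.
  by rewrite lt_min normr_gt0 mulf_neq0 ?invr_neq0 // divr_gt0.
apply: (@bounded_below_glue K (fun x => x - (rho + tau)%:C *: T x)) => //.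
- exact: shift_sym.
- by apply: shift_commute => // x; rewrite TK.
- by rewrite normr_gt0 mulf_neq0 ?invr_neq0.
- by rewrite divr_gt0.
- move=> x Kx; rewrite (TKx _ Kx) scalerA -{2}(scale1r x) -rmorphM /= -(rmorph1 (real_complex R)).
  rewrite -scalerBl -rmorphB /= hnormZ -[tau / rho]opprK normrN.
  by rewrite (_ : 1 - _ = - (tau / rho)) // mulrDl mulfV // opprD addrA subrr sub0r.
- move=> x Kx; have := lbK x Kx.
  have -> : x - (rho + tau)%:C *: T x = S x - tau%:C *: T x.
    by rewrite /S rmorphD /= scalerDl opprD addrA.
  have := hdistD 0 (S x) (tau%:C *: T x); have := hdistD (tau%:C *: T x) (S x) 0.
  rewrite !subr0 sub0r hnormN hnormZ => h _.
  have td : `|tau| <= d by rewrite /tau distrC ltW.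
  have hM : `|tau| * hnorm (T x) <= c1 / 2 * hnorm x.
    apply: (le_trans (ler_wpM2l (normr_ge0 tau) (TM x))).
    rewrite mulrA ler_wpM2r ?hnorm_ge0 // -ler_pdivlMr //.
  lra.
Qed.

(** With [y = (A - m) x], [<A x, x> = m |x|^2 + <T y, y>]. The part of [y] outside [E] has the
    favourable sign, and the lower bound of [T] controls the part inside by [x]. The sign [e] covers
    bounds from above and from below. *)
Lemma quadratic_bound E (e : R) : `|e| = 1 -> hproj E -> commute_op E T ->
  bounded_below_on T E -> (forall x, E x = 0 -> e * rdot (T x) x <= 0) ->
  exists M : R, forall x, dom A x ->
    dot (A x) x = (rdot (A x) x)%:C /\ e * rdot (A x) x <= M * hnorm x ^+ 2.
Proof.
move=> e1 Ep ET [c c0 lb] neg; have [Es EE] := Ep; exists (e * m + c^-1) => x dx.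
split.
  have := self_adjoint_sym dx dx; rewrite [dot x _]dotC /rdot.
  by case: (dot (A x) x) => u v [] vv; congr (_ +i* _); lra.
set y := A x - m%:C *: x; have Ty : T y = x by exact: TA.
have -> : rdot (A x) x = m * hnorm x ^+ 2 + rdot (T y) y.
  by rewrite Ty (rdotC x) /y rdotBl rdotZl sqr_hnorm; ring.
move: (y) Ty => {}y Ty; rewrite mulrDr mulrDl mulrA lerD2l.
have -> : rdot (T y) y = rdot (T (E y)) (E y) + rdot (T (y - E y)) (y - E y).
  rewrite (hsymB Ts) rdotBl !rdotBr -!ET.
  have -> : rdot (T y) (E y) = rdot (E (T y)) (E y) by rewrite (hsym_rdot Es) EE.
  have -> : rdot (E (T y)) y = rdot (E (T y)) (E y).
    by rewrite -{1}(EE (T y)) (hsym_rdot Es (E (T y))).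
  by ring.
have h2 : e * rdot (T (y - E y)) (y - E y) <= 0.
  by apply: neg; rewrite (hsymB Es) EE subrr.
have h1 : e * rdot (T (E y)) (E y) <= hnorm (T (E y)) * hnorm (E y).
  apply: le_trans (rdot_norm_le _ _); rewrite -[leRHS]mul1r -e1 -normrM; exact: ler_norm.
have h3 : hnorm (T (E y)) <= hnorm x by rewrite -ET Ty; exact: hproj_le.
have h4 : hnorm (E y) <= c^-1 * hnorm x.
  by rewrite ler_pdivlMl //; apply: le_trans h3; apply: lb; rewrite EE.
rewrite mulrDr; have h5 : hnorm (T (E y)) * hnorm (E y) <= hnorm x * (c^-1 * hnorm x).
  by apply: ler_pM; rewrite ?hnorm_ge0.
lra.
Qed.

(** A finite [s] falls under [exhaustion_finite] with [rho = s - m]. For [+oo], a lower bound of [T]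
    on [E] would make [A] bounded above, so the filtration by [T] is proper. *)
Lemma exhaustion_above E s : (m%:E < s)%E -> ext_Spec_ess dot A s ->
  hproj E -> commute_op E T -> (forall x, E x = 0 -> rdot (T x) x <= 0) ->
  exists2 P, exhaustion T E P & proper_in E P.
Proof.
move=> ms ess Ep ET neg; case: s ms ess => [r||] //.
  rewrite lte_fin => mr; rewrite -{1}(subrKC m r) => ess.
  apply: exhaustion_finite ess Ep ET _; first by rewrite subr_eq0 gt_eqF.
  by move=> x /neg h; rewrite mulr_ge0_le0 // subr_ge0 ltW.
move=> _ [[[[r]|[]]|[_ nb]]] //.
have [P exP [prP|bbT]] := exhaustion_exists Ts Tb Tinj Ep ET; first by exists P.
have [|M hM] := quadratic_bound (normr1 R) Ep ET bbT; first by move=> x /neg; rewrite mul1r.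
exfalso; apply: nb; exists M => x /hM[->].
by rewrite mul1r normE -rmorphXn -rmorphM /= lecR.
Qed.

Lemma exhaustion_below E s : (s < m%:E)%E -> ext_Spec_ess dot A s ->
  hproj E -> commute_op E T -> (forall x, E x = 0 -> 0 <= rdot (T x) x) ->
  exists2 P, exhaustion T E P & proper_in E P.
Proof.
move=> sm ess Ep ET pos; case: s sm ess => [r||] //.
  rewrite lte_fin => rm; rewrite -{1}(subrKC m r) => ess.
  apply: exhaustion_finite ess Ep ET _; first by rewrite subr_eq0 lt_eqF.
  by move=> x /pos h; rewrite mulr_le0_ge0 // subr_le0 ltW.
move=> _ [[[[r]|[_ nb]]|[]]] //.
have [P exP [prP|bbT]] := exhaustion_exists Ts Tb Tinj Ep ET; first by exists P.
have N1 : `|-1| = 1 :> R by rewrite normrN normr1.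
have [|M hM] := quadratic_bound N1 Ep ET bbT; first by move=> x /pos h; lra.
exfalso; apply: nb; exists (- M) => x /hM[->].
rewrite normE -rmorphXn -rmorphM /= lecR; lra.
Qed.

End Resolvent.

(** * The construction at points outside the spectrum and at discrete eigenvalues *)

Lemma Lambda_gap (l : R) (s t : \bar R) : ~ Spec A l -> (s < l%:E < t)%E ->
  ext_Spec_ess dot A s -> ext_Spec_ess dot A t ->
  exists L : nat -> set H, [/\ Lambda dot A L, forall k : nat, L k `<=` L k.+1
    & forall k : nat, (EFin @` Spec_in dot A (L k)) l%:E].
Proof.
move=> nl /andP[sl lt_] ess_s ess_t.
have [T [Ts Tb Tinj AT TA]] := resolvent_real nl.
have [E [Ep Tpos Tneg EC]] := sign_proj Ts Tb.
have ET : commute_op E T by move=> x; rewrite (EC T).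
have [Es EE] := Ep.
have [P exP prP] := exhaustion_above Ts Tb Tinj AT TA lt_ ess_t Ep ET Tneg.
have [P' exP' prP'] :
    exists2 P', exhaustion T (fun x => x - E x) P' & proper_in (fun x => x - E x) P'.
  apply: (exhaustion_below Ts Tb Tinj AT TA sl ess_s (hproj_compl Ep)) => x.
    by rewrite (hsymB Ts) ET.
  by move/eqP; rewrite subr_eq0 => /eqP {1 2}->; exact: Tpos.
have [Q [Qp QT QS [Qran Q0 Qiso]]] := isotropic_vectors Ts Ep ET Tpos Tneg exP prP exP' prP'.
have Qle m n z : (m <= n)%N -> Q n (Q m z) = Q m z by exact: increasing_hproj_le.
have Qge m n z : (m <= n)%N -> Q m (Q n z) = Q m z by exact: increasing_hproj_ge.
have /choice[f hf] := Qiso; have /choice[y hy] := hf.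
(* The indices are chosen so that [x k] lies in the range of [Q (n k.+1)], which makes the ranges of
   the [Q1 k] increase. *)
pose n := fix n k := if k is j.+1 then f (n j) else 0%N.
have nS k : (n k < n k.+1)%N by have [] := hy (n k).
have n_ge k : (k <= n k)%N by elim: k => // k IH; apply: leq_ltn_trans IH (nS k).
pose z k := y (n k).
have hz k : [/\ z k != 0, Q (n k.+1) (z k) = z k, Q (n k) (z k) = 0 & rdot (T (z k)) (z k) = 0].
  by have [] := hy (n k).
pose x k := T (z k).
have Qnx k : Q (n k) (x k) = 0 by have [_ _ h _] := hz k; rewrite /x QT h (hsym0 Ts).
have QSx k : Q (n k.+1) (x k) = x k by have [_ h _ _] := hz k; rewrite /x QT h.
have Qline k w : Q (n k) (line_proj (x k) w) = 0.
  by rewrite /line_proj (hsymZ (Qp _).1) Qnx scaler0.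
pose Q1 k w := Q (n k) w + line_proj (x k) w.
have Q1p k : hproj (Q1 k) by apply: hproj_add => //; exact: line_projP.
have Q1Q k w : Q (n k.+1) (Q1 k w) = Q1 k w.
  rewrite /Q1 (hsymD (Qp _).1) Qle; last exact/ltnW/nS.
  by rewrite /line_proj (hsymZ (Qp _).1) QSx.
apply: (@increasing_Lambda l Q1) => //.
- move=> k w; rewrite {1}/Q1 Q1Q -[X in line_proj _ X]Q1Q /line_proj (Qp _).1 Qnx.
  by rewrite dot0r mul0r scale0r addr0.
- move=> w Q1w; apply: Q0 => k; rewrite -(Qge _ _ _ (n_ge k)).
  have := congr1 (Q (n k)) (Q1w k); rewrite /Q1 (hsymD (Qp _).1) (Qp _).2 Qline addr0.
  by move->; rewrite !(hsym0 (Qp _).1).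
- move=> k w Q1w; have Qw : Q (n k.+1) w = w by rewrite -Q1w Q1Q.
  by have [v <-] := Qran _ _ Qw; exact: (AT v).1.
- move=> k; exists (x k); have [z0 _ Qz Tz] := hz k; split.
  + by apply: contra_neq z0; exact: Tinj.
  + by rewrite /Q1 Qnx line_proj_id add0r.
  (* Here [A (x k) = l x k + z k], and both summands of [Q1 k] kill [z k], the second because [z k]
     is isotropic. *)
  + have [_ ->] := AT (z k); rewrite -/(x k) /Q1 (hsymP (Qp _).1) Qnx Qz scaler0 !add0r.
    rewrite (hsymP (line_projP _).1) line_proj_id /line_proj.
    have -> : dot (z k) (x k) = 0 by rewrite -Ts dot_sym_real // Tz.
    by rewrite mul0r scale0r addr0.
Qed.

(** The exhausting subspaces reduce the resolvent at a nearby point [m], so a nonzero projection of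
    an eigenvector onto one of them is again an eigenvector. *)
Lemma Lambda_eigenvalue (l : R) : discrete_Spec A l ->
  exists L : nat -> set H, [/\ Lambda dot A L, forall k : nat, L k `<=` L k.+1
    & forall k : nat, (EFin @` Spec_in dot A (L k)) l%:E].
Proof.
move=> [[_ [V /nbhs_ballP[d /= d0 dV] VS]] [u [du Au] u0] _].
(* A point of the isolating ball other than its centre is outside the spectrum. *)
pose m := l + d / 2.
have d20 : 0 < d / 2 by rewrite divr_gt0.
have nm : ~ Spec A m.
  move=> sm; have : (V `&` Spec A) m.
    split=> //; apply: dV; rewrite -ball_normE /= /m opprD addrA subrr sub0r normrN.
    by rewrite gtr0_norm //; lra.
  by rewrite VS /= /m => h; lra.
have [T [Ts Tb Tinj AT TA]] := resolvent_real nm.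
have [P [Pp PT _ [PS Pran P0]] _] := exhaustion_exists Ts Tb Tinj hproj_id (fun x => erefl).
have Tu : u = - (d / 2)%:C *: T u.
  have := TA u du; rewrite Au -scalerBl -rmorphB /= /m opprD addrA subrr sub0r.
  by rewrite (hsymZ Ts) rmorphN.
(* The sequence will start at [k0], from where on the projections of [u] are nonzero. *)
have [k0 Pk0] : exists k, P k u != 0.
  apply: contrapT => h; move/eqP: u0; apply; apply: P0 => // j.
  by apply/eqP; apply: contra_notT h => ?; exists j.
have Pge m1 n1 x : (m1 <= n1)%N -> P m1 (P n1 x) = P m1 x by exact: increasing_hproj_ge.
have Pdom k w : P k w = w -> dom A w.
  by move=> Pw; have [v <-] := Pran k w Pw; exact: (AT v).1.
apply: (@increasing_Lambda l (fun k => P (k0 + k)%N)) => //.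
- by move=> k x; rewrite addnS PS.
- move=> y Py; apply: P0 => // k; rewrite -(Pge k (k0 + k)%N) ?leq_addl // Py.
  exact: hsym0 (Pp _).1.
- by move=> k; exact: Pdom.
- move=> k; exists (P (k0 + k)%N u); split.
  + by apply: contra_neq Pk0 => h; rewrite -(Pge k0 (k0 + k)%N) ?leq_addr // h (hsym0 (Pp _).1).
  + exact: (Pp _).2.
  + set v := P _ u.
    have Tv : v = - (d / 2)%:C *: T v by rewrite /v {1}Tu (hsymZ (Pp _).1) PT.
    suff -> : A v = l%:C *: v by rewrite (hsymZ (Pp _).1) (Pp _).2.
    have [_] := AT (- (d / 2)%:C *: v).
    rewrite (hsymZ Ts) -Tv => ->; rewrite -scalerDl /m rmorphD /= addrK //.
Qed.

End Operator.
End HilbertSpace.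

Theorem theorem2p1 (R : realType) (H : completeNormedModType R[i])
    (dot : {dot H for Num.conj}) (Hdot : norm_of_dot dot)
    (A : operator H) (HA : self_adjoint dot A) (lambda : \bar R)
    (Hlambda : (ext_conv (ext_Spec_ess dot A) `\` ext_Spec_ess dot A) lambda) :
  exists L : nat -> set H,
    [/\ Lambda dot A L,
        forall k : nat, L k `<=` L k.+1
      & forall k : nat, (EFin @` Spec_in dot A (L k)) lambda].
Proof.
have [[s [t [ess_s ess_t /andP[sle tle]]]] ness] := Hlambda.
(* The endpoints are essential and [lambda] is not, so both inequalities are strict, which also
   makes [lambda] finite. *)
have {sle}sl : (s < lambda)%E.
  by rewrite lt_neqAle sle andbT; apply: contra_not_neq ness => <-.
have {tle}lt_ : (lambda < t)%E.
  by rewrite lt_neqAle tle andbT; apply: contra_not_neq ness => ->.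
case: lambda sl lt_ ness {Hlambda} => [l sl lt_ ness|_ lt_ _|sl _ _]; last first.
- by move: sl; rewrite ltNge leNye.
- by move: lt_; rewrite ltNge leey.
have [sp|nsp] := pselect (Spec A l); last first.
  by apply: (Lambda_gap Hdot HA nsp _ ess_s ess_t); rewrite sl.
apply: (Lambda_eigenvalue Hdot HA); apply: contrapT => nd; apply: ness; split.
  by left; left; exists l.
by move=> [r dr [rl]]; apply: nd; rewrite -rl.
Qed.
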